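(* Let $\mu>0$ and $\lambda_n=n\mu$. Let $A$ and $S$ be independent rate-$1$ Poisson processes, and for each $n\ge1$ let $Q_n(0)$ be a nonnegative-integer-valued random variable independent of $(A,S)$ and let $Q_n$ be the process determined by $$Q_n(t)=Q_n(0)+A(\lambda_n t)-S\left(\mu\int_0^t Q_n(s)\,ds\right),\quad t\ge0.$$ Let $X_n(t)=(Q_n(t)-n)/\sqrt n$ and $$M_{n,1}(t)=\frac{A(\lambda_n t)-\lambda_n t}{\sqrt n},\qquad M_{n,2}(t)=\frac{1}{\sqrt n}\left[S\left(\mu\int_0^tQ_n(s)\,ds\right)-\mu\int_0^tQ_n(s)\,ds\right].$$ If $E[Q_n(0)]<\infty$ for each $n\ge1$, then $$X_n(t)=X_n(0)+M_{n,1}(t)-M_{n,2}(t)-\mu\int_0^tX_n(s)\,ds,\quad t\ge0,$$ and $M_{n,1},M_{n,2}$ are square-integrable martingales with respect to the filtration $\mathbf F_n=\{\mathcal F_{n,t}:t\ge0\}$ defined by $$\mathcal F_{n,t}=\sigma\left(Q_n(0),A(\lambda_n s),S\left(\mu\int_0^sQ_n(u)\,du\right):0\le s\le t\right),$$ augmented by including all null sets. Their predictable quadratic variations are $$\langle M_{n,1}\rangle(t)=\frac{\lambda_n t}{n},\qquad \langle M_{n,2}\rangle(t)=\frac{\mu}{n}\int_0^tQ_n(s)\,ds,\quad t\ge0,$$ with $E[\langle M_{n,2}\rangle(t)]<\infty$ for all $t\ge0$, $n\ge1$, and their optional quadratic variations are $$[M_{n,1}](t)=\frac{A(\lambda_nt)}{n},\qquad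 [M_{n,2}](t)=\frac{1}{n}S\left(\mu\int_0^tQ_n(s)\,ds\right),\quad t\ge0.$$
   Context: A martingale $M$ is square integrable if $E[M(t)^2]<\infty$ for each $t\ge0$. For such $M$ the predictable quadratic variation $\langle M\rangle$ is the unique nondecreasing nonnegative predictable process with $E[\langle M\rangle(t)]<\infty$ for all $t$ such that $M^2-\langle M\rangle$ is a martingale (with $\langle M\rangle(0)=0$ when $M(0)=0$). For a local martingale $M$ with $M(0)=0$, the optional quadratic variation $[M]$ is the unique process of finite variation on bounded intervals with $[M](0)=0$ such that $M^2-[M]$ is a local martingale and $\Delta[M]=(\Delta M)^2$, where $\Delta M(t)=M(t)-M(t-)$. The defining equation for $Q_n$ is solved recursively over successive jump times, giving a unique process with right-continuous piecewise-constant paths. *)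

(* Defs.v *)
From HB Require Import structures.
From mathcomp Require Import all_boot all_order all_algebra.
From mathcomp Require Import all_classical all_reals all_analysis.

Set Implicit Arguments.
Unset Strict Implicit.
Unset Printing Implicit Defensive.

Import Order.TTheory GRing.Theory Num.Theory.
Import numFieldNormedType.Exports.

Local Open Scope classical_set_scope.
Local Open Scope ring_scope.

(* Stochastic processes are families indexed by R of which only the times
   t >= 0 are relevant: every condition below is relativized to t >= 0. *)

Section paths.
Context {R : realType}.

Definition cadlag (f : R -> R) :=
  (forall t, 0 <= t -> f s @[s --> t^'+] --> f t) /\
  (forall t, 0 < t -> cvg (f s @[s --> t^'-])).

Definition jump (f : R -> R) (t : R) : R := f t - lim (f s @[s --> t^'-]).

(* For integer-valued paths, convergence is eventual constancy.  By compactness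
   the two clauses give finitely many jumps on each bounded interval. *)
Definition rc_piecewise_constant (f : R -> nat) :=
  (forall t, 0 <= t -> \forall s \near t^'+, f s = f t) /\
  (forall t, 0 < t -> exists k, \forall s \near t^'-, f s = k).

End paths.

Section sigma_fields.
Context {d : measure_display} {T : measurableType d} {R : realType}.
Variable P : probability T R.

Definition process_events {d' : measure_display} {E : measurableType d'}
    (D : set R) (Y : R -> T -> E) : set (set T) :=
  [set B | exists t U, [/\ D t, measurable U & B = Y t @^-1` U]].

Definition independent (G H : set (set T)) :=
  forall B C, G B -> H C -> P (B `&` C) = (P B * P C)%E.

(* Null sets are taken in the sigma-algebra of T, so that no completeness is
   required of P; if P is complete these are all the P-negligible sets. *)
Definition null_sets : set (set T) := [set N | measurable N /\ P N = 0%E].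

End sigma_fields.

Section poisson_process.
Context {d : measure_display} {T : measurableType d} {R : realType}.
Variable P : probability T R.

(* The subtractions are truncated, harmlessly since the paths are
   nondecreasing. *)
Record poisson_process (rate : R) (N : R -> {RV P >-> nat}) : Prop := {
  poisson_process0 : forall w, N 0 w = 0%N ;
  poisson_process_nondecreasing :
    forall w s t, 0 <= s -> s <= t -> (N s w <= N t w)%N ;
  poisson_process_right_continuous :
    forall w t, 0 <= t -> \forall s \near t^'+, N s w = N t w ;
  poisson_process_increment :
    forall s t k, 0 <= s -> s < t ->
      P [set w | (N t w - N s w)%N = k] =
      (poisson_pmf (rate * (t - s)) k)%:E ;
  poisson_process_independent_increments :
    forall (m : nat) (t : nat -> R) (U : nat -> set nat),
      0 <= t 0%N -> (forall i, t i <= t i.+1) ->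
      P (\bigcap_(i in `I_m) [set w | U i (N (t i.+1) w - N (t i) w)%N]) =
      (\prod_(i < m) P [set w | U i (N (t i.+1) w - N (t i) w)%N])%E
}.

End poisson_process.

Section martingales.
Context {d : measure_display} {T : measurableType d} {R : realType}.
Variable P : probability T R.
Implicit Types (F : R -> set (set T)) (M V : R -> T -> R).

Definition filtration F :=
  [/\ forall t, 0 <= t -> sigma_algebra [set: T] (F t),
      forall t, 0 <= t -> F t `<=` measurable
    & forall s t, 0 <= s -> s <= t -> F s `<=` F t].

Definition measurable_wrt (G : set (set T)) (Y : T -> R) :=
  forall U : set R, measurable U -> G (Y @^-1` U).

Definition adapted F M := forall t, 0 <= t -> measurable_wrt (F t) (M t).

(* Y is a version of E[X | G] *)
Definition is_cond_expectation (G : set (set T)) (X Y : T -> R) :=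
  [/\ measurable_wrt G Y, P.-integrable [set: T] (EFin \o Y)
    & forall B, G B ->
        (\int[P]_(w in B) (Y w)%:E = \int[P]_(w in B) (X w)%:E)%E].

Definition martingale F M :=
  [/\ adapted F M,
      forall t, 0 <= t -> P.-integrable [set: T] (EFin \o M t),
      forall s t, 0 <= s -> s <= t -> is_cond_expectation (F s) (M t) (M s)
    & forall w, cadlag (M ^~ w)].

Definition square_integrable_martingale F M :=
  martingale F M /\
  forall t, 0 <= t -> ('E_P[(fun w => M t w ^+ 2)%R] < +oo)%E.

Definition stopping_time F (tau : T -> \bar R) :=
  (forall w, 0 <= tau w)%E /\
  forall t, 0 <= t -> F t [set w | (tau w <= t%:E)%E].

Definition stopped M (tau : T -> \bar R) : R -> T -> R :=
  fun t w => M (fine (mine t%:E (tau w))) w.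

Definition local_martingale F M :=
  [/\ adapted F M, forall w, cadlag (M ^~ w)
    & exists tau : nat -> T -> \bar R,
      [/\ forall k, stopping_time F (tau k),
          forall w k, (tau k w <= tau k.+1 w)%E,
          {ae P, forall w, (tau k w) @[k --> \oo] --> +oo%E}
        & forall k, martingale F (stopped M (tau k))]].

Definition predictable_rectangles F : set (set (R * T)) :=
  [set C | exists2 B, F 0 B & C = [set 0] `*` B] `|`
  [set C | exists s t B, [/\ 0 <= s, s < t, F s B & C = `]s, t] `*` B]].

Definition predictable F V :=
  let time_space := `[0, +oo[ `*` [set: T] in
  forall U : set R, measurable U ->
    <<s time_space, predictable_rectangles F >>
      (time_space `&` [set z | U (V z.1 z.2)]).

Definition predictable_quadratic_variation F M V :=
  square_integrable_martingale F M /\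
  [/\ forall w s t, 0 <= s -> s <= t -> V s w <= V t w,
      forall w t, 0 <= t -> 0 <= V t w,
      predictable F V
    & forall t, 0 <= t -> ('E_P[V t] < +oo)%E] /\
  martingale F (fun t w => M t w ^+ 2 - V t w) /\
  ((forall w, M 0 w = 0) -> forall w, V 0 w = 0).

(* The jump relation is an equality of processes up to indistinguishability. *)
Definition optional_quadratic_variation F M V :=
  local_martingale F M /\
  (forall w, M 0 w = 0) /\
  [/\ forall w, V 0 w = 0,
      forall w t, 0 <= t -> bounded_variation 0 t (V ^~ w),
      local_martingale F (fun t w => M t w ^+ 2 - V t w)
    & {ae P, forall w, forall t, 0 < t ->
        jump (V ^~ w) t = jump (M ^~ w) t ^+ 2}].

End martingales.

Section infinite_server_queue.
Context {d : measure_display} {T : measurableType d} {R : realType}.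
Context {P : probability T R}.
Variables (mu : R) (A S : R -> {RV P >-> nat}) (Q : nat -> R -> {RV P >-> nat}).
Variable n : nat.

Definition arrival_rate : R := n%:R * mu.

Definition arrivals (t : R) (w : T) : nat := A (arrival_rate * t) w.

Definition service_clock (t : R) (w : T) : R :=
  mu * \int[lebesgue_measure]_(s in `[0, t]) (Q n s w)%:R.

Definition departures (t : R) (w : T) : nat := S (service_clock t w) w.

Definition queue_equation := forall w t, 0 <= t ->
  (Q n t w)%:R = (Q n 0 w)%:R + (arrivals t w)%:R - (departures t w)%:R :> R.

Definition scaled_queue (t : R) (w : T) : R :=
  ((Q n t w)%:R - n%:R) / Num.sqrt n%:R.

Definition centered_arrivals (t : R) (w : T) : R :=
  ((arrivals t w)%:R - arrival_rate * t) / Num.sqrt n%:R.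

Definition centered_departures (t : R) (w : T) : R :=
  (Num.sqrt n%:R)^-1 * ((departures t w)%:R - service_clock t w).

Definition queue_filtration (t : R) : set (set T) :=
  <<s process_events [set 0] (fun s => Q n s) `|`
      process_events `[0, t] arrivals `|`
      process_events `[0, t] departures `|`
      null_sets P >>.

End infinite_server_queue.

(* Main.v *)
Require Import Defs.
From mathcomp Require Import all_boot all_order all_algebra.
From mathcomp Require Import all_classical all_reals all_analysis.
From mathcomp Require Import measurable_realfun.
From mathcomp Require Import ring lra zify.

Set Implicit Arguments.
Unset Strict Implicit.
Unset Printing Implicit Defensive.

Import Order.TTheory GRing.Theory Num.Theory.
Import numFieldNormedType.Exports.

Local Open Scope classical_set_scope.
Local Open Scope ring_scope.

(** Both martingales are compensated unit-rate Poisson processes [N u - u] run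
    along a random clock [C]: the arrivals along [C t = lambda_n t], the departures
    along [C t = mu * int_0^t Q_n].  In each case [N] is a Poisson process for the
    filtration [G] generated by [Q_n(0)], the whole of the other process, and [N] up
    to the current level, and [C t] is a stopping time of [G].  For the service
    process this rests on the observation that departures stopped at level [u] of the
    clock can be reconstructed one at a time from [Q_n(0)], [A] and [S] up to [u].

    The martingale property at the levels [C s <= C t] follows from optional stopping
    at [min (C t) b] and [b -> oo].  All processes of interest, namely [M], [M^2 - <M>]
    and [M^2 - [M]], are of the form [a (x - u) + b ((x - u)^2 - u)] with [u = C t],
    [x = N (C t)], so they are treated at once.  Only [E Q_n(0) < oo] is assumed, so
    the second moment of [M] comes from [E (N t' - t')^2 = E t'] at [t' = min (C t) b];
    the error on [{C t > b}] is handled through a bound [K >= C t] independent of [N],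
    for which [E |N b - b|^2 1_{K > b} = b P(K > b) -> 0]. *)


(** * The Poisson distribution *)

(** The obstacle is a circle: departures are counted by a clock which the departures themselves
    drive. Nothing explicit is known about the law of [C t], so the clock enters only through events
    [{C t <= u}], which can be decided from the services up to level [u]. One whole process is put
    into the past of level 0 for two reasons. The queue is bounded by its initial length plus the
    arrivals, so the bound on the service clock is known at level 0 and is independent of the
    process being stopped; and the departures, which belong to the observed filtration, become known
    on the arrival side. Since [Q_n(0)] has only a first moment, integrability of [K] must carry the
    passage [b -> oo]. It does, because [b P(K > b)] is at most the integral of [K] over [{K > b}].
    That a Poisson path jumps by one is not among the defining clauses. It is derived from the law
    of the increments, outside a null set, which is why the jump relation for the optional variation
    holds almost surely. *)

Section poisson_moments.
Context {R : realType}.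
Implicit Types x : R.

Lemma poisson_pmfS x k : 0 < x ->
  k.+1%:R * poisson_pmf x k.+1 = x * poisson_pmf x k.
Proof.
move=> x0; rewrite /poisson_pmf x0 exprS factS natrM.
have k0 : k`!%:R != 0 :> R by rewrite pnatr_eq0 -lt0n fact_gt0.
have k1 : k.+1%:R != 0 :> R by rewrite pnatr_eq0.
rewrite invfM; transitivity (x * (x ^+ k / k`!%:R * expR (- x)) * (k.+1%:R / k.+1%:R)).
  by ring.
by rewrite divff// mulr1.
Qed.

Lemma nneseries_poisson_pmf x : 0 < x ->
  (\sum_(0 <= k <oo) (poisson_pmf x k)%:E = 1)%E.
Proof.
move=> x0; rewrite nneseries_esumT; last first.
  by move=> *; rewrite lee_fin poisson_pmf_ge0.
have : poisson_prob x 0 [set: nat] = 1%E by exact: probability_setT.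
by rewrite /poisson_prob x0.
Qed.

(** The Stein-Chen identity: the factor [k] shifts the Poisson weights by one and kills the term at
    0. Taking [g k = 1] and [g k = k] gives the first two moments. *)
Lemma nneseries_poisson_shift x (g : nat -> R) : 0 < x -> (forall k, 0 <= g k) ->
  (\sum_(0 <= k <oo) (k%:R * g k * poisson_pmf x k)%:E =
   x%:E * \sum_(0 <= k <oo) (g k.+1 * poisson_pmf x k)%:E)%E.
Proof.
move=> x0 g0; rewrite -nneseriesZl; last first.
  by move=> k _; rewrite lee_fin mulr_ge0 ?poisson_pmf_ge0.
have shiftE n : (\sum_(0 <= k < n.+1) (k%:R * g k * poisson_pmf x k)%:E =
    \sum_(0 <= k < n) (x%:E * (g k.+1 * poisson_pmf x k)%:E))%E.
  rewrite big_nat_recl//= !mul0r add0e; apply: eq_bigr => k _.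
  by rewrite mulrAC poisson_pmfS// -EFinM; congr EFin; ring.
apply: cvg_lim => //; rewrite -cvg_shiftS.
rewrite (_ : [sequence _]_n = fun n =>
    (\sum_(0 <= k < n) (x%:E * (g k.+1 * poisson_pmf x k)%:E))%E); last first.
  by apply/funext => n; rewrite -shiftE.
apply: is_cvg_nneseries => k _ _.
by rewrite -EFinM lee_fin !mulr_ge0 ?poisson_pmf_ge0// ltW.
Qed.

Lemma poisson_mean x : 0 < x ->
  (\sum_(0 <= k <oo) (k%:R * poisson_pmf x k)%:E = x%:E)%E.
Proof.
move=> x0; transitivity (\sum_(0 <= k <oo) (k%:R * 1 * poisson_pmf x k)%:E)%E.
  by apply: eq_eseriesr => k _; rewrite mulr1.
rewrite nneseries_poisson_shift//.
under eq_eseriesr do rewrite mul1r.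
by rewrite nneseries_poisson_pmf// mule1.
Qed.

Lemma poisson_second_moment x : 0 < x ->
  (\sum_(0 <= k <oo) (k%:R ^+ 2 * poisson_pmf x k)%:E = (x + x ^+ 2)%:E)%E.
Proof.
move=> x0; under eq_eseriesr do rewrite expr2.
rewrite nneseries_poisson_shift//.
under eq_eseriesr do rewrite -addn1 natrD mulrDl mul1r EFinD.
rewrite nneseriesD; last 2 first.
  by move=> k _; rewrite lee_fin mulr_ge0 ?poisson_pmf_ge0.
  by move=> k _; rewrite lee_fin poisson_pmf_ge0.
rewrite poisson_mean// nneseries_poisson_pmf// -EFinD -EFinM.
by congr EFin; ring.
Qed.

End poisson_moments.

Section poisson_integrals.
Context {d : measure_display} {T : measurableType d} {R : realType}.
Variable P : probability T R.
Implicit Types (B : set T) (Y : T -> nat).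

Lemma measurable_nat_fun Y : (forall k, measurable [set w | Y w = k]) ->
  measurable_fun [set: T] Y.
Proof.
move=> mY _ U _; rewrite setTI.
rewrite (_ : _ @^-1` _ = \bigcup_(k in U) [set w | Y w = k]).
  exact: bigcup_measurable.
by apply/seteqP; split => [w Uw|w [k Uk /= ->]//]; exists (Y w).
Qed.

Lemma ge0_integral_nat_fun B Y (f : nat -> R) : measurable B ->
  (forall k, measurable [set w | Y w = k]) -> (forall k, 0 <= f k) ->
  (\int[P]_(w in B) (f (Y w))%:E =
   \sum_(0 <= k <oo) (f k)%:E * P (B `&` [set w | Y w = k]))%E.
Proof.
move=> mB mY f0.
have mF k : measurable (B `&` [set w | Y w = k]) by exact: measurableI.
have BE : B = \bigcup_k (B `&` [set w | Y w = k]).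
  by apply/seteqP; split => [w Bw|w [k _ []]//]; exists (Y w).
rewrite {1}BE ge0_integral_bigcup//=.
- apply: eq_eseriesr => k _.
  rewrite (eq_integral (cst (f k)%:E)); last first.
    by move=> w; rewrite inE => -[_ /= ->].
  by rewrite integral_cst.
- rewrite -BE; apply/measurable_EFinP/measurable_funTS.
  by apply: (measurableT_comp (f := f)) => //; exact: measurable_nat_fun.
- by move=> w _; rewrite lee_fin.
- by move=> i j _ _ [w [[_ /= <-] [_ /= <-]]].
Qed.

Variable x : R.
Hypothesis x0 : 0 < x.
Variables (B : set T) (Y : T -> nat).
Hypothesis mB : measurable B.
Hypothesis mY : forall k, measurable [set w | Y w = k].
(** [Y] is Poisson and independent of the single event [B]: the form in which an increment meets an
    event of the past. Quadratics in [Y] suffice below, because [charlier] is a quadratic in the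
    increment once the earlier count is fixed. *)
Hypothesis BY : forall k,
  P (B `&` [set w | Y w = k]) = (P B * (poisson_pmf x k)%:E)%E.

Let fP := fineK (fin_num_measure P B mB).

Lemma ge0_integral_poisson (f : nat -> R) : (forall k, 0 <= f k) ->
  (\int[P]_(w in B) (f (Y w))%:E =
   P B * \sum_(0 <= k <oo) (f k * poisson_pmf x k)%:E)%E.
Proof.
move=> f0; rewrite ge0_integral_nat_fun// -fP -nneseriesZl; last first.
  by move=> k _; rewrite lee_fin mulr_ge0 ?poisson_pmf_ge0.
by apply: eq_eseriesr => k _; rewrite BY fP EFinM muleCA.
Qed.

Let mYR : measurable_fun B (fun w => (Y w)%:R : R).
Proof.
apply: measurable_funTS; apply: (measurableT_comp (f := fun k => k%:R : R)) => //.
exact: measurable_nat_fun.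
Qed.

Let intY : (\int[P]_(w in B) (Y w)%:R%:E = (fine (P B) * x)%:E)%E.
Proof.
by rewrite (ge0_integral_poisson (f := fun k => k%:R))// poisson_mean// EFinM fP.
Qed.

Let intY2 : (\int[P]_(w in B) ((Y w)%:R ^+ 2)%:E =
  (fine (P B) * (x + x ^+ 2))%:E)%E.
Proof.
rewrite (ge0_integral_poisson (f := fun k => k%:R ^+ 2)) ?poisson_second_moment//.
by rewrite EFinM fP.
Qed.

Let iY : P.-integrable B (EFin \o (fun w => (Y w)%:R)).
Proof.
apply/integrableP; split; first exact/measurable_EFinP.
under eq_integral do rewrite /= ger0_norm//.
by rewrite intY ltry.
Qed.

Let iY2 : P.-integrable B (EFin \o (fun w => (Y w)%:R ^+ 2)).
Proof.
apply/integrableP; split; first exact/measurable_EFinP/measurable_funX.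
under eq_integral do rewrite /= ger0_norm ?exprn_ge0//.
by rewrite intY2 ltry.
Qed.

Lemma integrable_poisson_quadratic (a b c : R) :
  P.-integrable B (EFin \o (fun w => a + b * (Y w)%:R + c * (Y w)%:R ^+ 2)).
Proof.
apply: (integrableD mB (f := EFin \o (fun w => a + b * (Y w)%:R))
  (g := EFin \o (fun w => c * (Y w)%:R ^+ 2))); last exact: (integrableZl mB c iY2).
apply: (integrableD mB (f := EFin \o cst a) (g := EFin \o (fun w => b * (Y w)%:R))).
  exact: finite_measure_integrable_cst.
exact: (integrableZl mB b iY).
Qed.

Lemma Rintegral_poisson_quadratic (a b c : R) :
  \int[P]_(w in B) (a + b * (Y w)%:R + c * (Y w)%:R ^+ 2) =
  fine (P B) * (a + b * x + c * (x + x ^+ 2)).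
Proof.
have i1 : P.-integrable B (EFin \o (fun w => b * (Y w)%:R)) by exact: (integrableZl mB b iY).
have i2 : P.-integrable B (EFin \o (fun w => c * (Y w)%:R ^+ 2)) by exact: (integrableZl mB c iY2).
have i0 : P.-integrable B (EFin \o cst a) by exact: finite_measure_integrable_cst.
rewrite RintegralD//; last exact: (integrableD mB i0 i1).
rewrite RintegralD// !RintegralZl// (Rintegral_cst P mB a).
by rewrite /Rintegral intY intY2 /=; ring.
Qed.

End poisson_integrals.

(** * Poisson processes in a filtration *)

Section sigma_algebras.
Context {T : pointedType} (G : set (set T)).
Hypothesis sG : sigma_algebra [set: T] G.

Lemma sigma_algebra_measurableE : @measurable _ (g_sigma_algebraType G) = G.
Proof. exact: measurable_g_measurableTypeE. Qed.

Lemma sigma_algebra_setT : G [set: T].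
Proof. by rewrite -sigma_algebra_measurableE; exact: measurableT. Qed.

Lemma sigma_algebra_setC B : G B -> G (~` B).
Proof. by rewrite -sigma_algebra_measurableE; exact: measurableC. Qed.

Lemma sigma_algebra_setI B C : G B -> G C -> G (B `&` C).
Proof. by rewrite -sigma_algebra_measurableE; exact: measurableI. Qed.

Lemma sigma_algebra_setU B C : G B -> G C -> G (B `|` C).
Proof. by rewrite -sigma_algebra_measurableE; exact: measurableU. Qed.

Lemma sigma_algebra_bigcup_nat (D : set nat) (F : (set T)^nat) :
  (forall k, D k -> G (F k)) -> G (\bigcup_(k in D) F k).
Proof. by rewrite -sigma_algebra_measurableE; exact: bigcup_measurable. Qed.

Lemma sigma_algebra_bigcup_rat (F : rat -> set T) :
  (forall q, G (F q)) -> G (\bigcup_q F q).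
Proof. by rewrite -sigma_algebra_measurableE; exact: bigcupT_measurable_rat. Qed.

End sigma_algebras.

Section charlier_martingale.
Context {d : measure_display} {T : measurableType d} {R : realType}.
Variable P : probability T R.
Implicit Types (B : set T) (u v : R).

(* Combinations of the first two Poisson-Charlier polynomials: with
   (a, b) = (1, 0) this is the compensated process, with (0, 1) its square minus
   the predictable variation, and with (-1, 1) its square minus the jumps. *)
Definition charlier (a b u x : R) : R := a * (x - u) + b * ((x - u) ^+ 2 - u).

(** [pf_increment] states the law of an increment and its independence from the past in one formula.
    [G] may be larger than the filtration generated by [N], as it has to carry the initial queue
    length and the other Poisson process. *)
Record poisson_in_filtration (G : R -> set (set T)) (N : R -> T -> nat) : Prop :=
  PoissonInFiltration {
  pf_filtration : filtration G ;
  pf_adapted : forall u k, 0 <= u -> G u [set w | N u w = k] ;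
  pf_increment : forall u v B k, 0 <= u -> u < v -> G u B ->
    P (B `&` [set w | (N v w - N u w)%N = k]) =
    (P B * (poisson_pmf (v - u) k)%:E)%E ;
  pf0 : forall w, N 0 w = 0%N ;
  pf_nondecreasing : forall w u v, 0 <= u -> u <= v -> (N u w <= N v w)%N ;
  pf_right_continuous : forall w u, 0 <= u -> \forall v \near u^'+, N v w = N u w
}.

Variables (G : R -> set (set T)) (N : R -> T -> nat).
Hypothesis GN : poisson_in_filtration G N.

Lemma pf_measurable u B : 0 <= u -> G u B -> measurable B.
Proof. by move=> u0; have [_ + _] := pf_filtration GN; apply. Qed.

Lemma pf_mono u v B : 0 <= u -> u <= v -> G u B -> G v B.
Proof. by move=> u0 uv; have [_ _] := pf_filtration GN; apply. Qed.

Lemma pf_measurable_eq u k : 0 <= u -> measurable [set w | N u w = k].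
Proof. by move=> u0; apply: (pf_measurable u0); exact: (pf_adapted GN). Qed.

Lemma pf_measurable_fun u : 0 <= u -> measurable_fun [set: T] (N u).
Proof. by move=> u0; apply: measurable_nat_fun => k; exact: pf_measurable_eq. Qed.

Lemma pf_measurable_increment u v k : 0 <= u -> u <= v ->
  measurable [set w | (N v w - N u w)%N = k].
Proof.
move=> u0 uv; have v0 := le_trans u0 uv.
rewrite (_ : [set _ | _] = \bigcup_i ([set w | N v w = i] `&`
    \bigcup_(j in [set j | (i - j)%N = k]) [set w | N u w = j])); last first.
  apply/seteqP; split => [w /= Nw|w [i _ [/= <-] [j /= jk Nw]]].
    by exists (N v w) => //; split => //; exists (N u w).
  by rewrite /= Nw.
apply: bigcupT_measurable => i; apply: measurableI; first exact: pf_measurable_eq.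
by apply: bigcup_measurable => j _; exact: pf_measurable_eq.
Qed.

Lemma charlier_increment a b v x y : charlier a b v (x + y) =
  (a * (x - v) + b * ((x - v) ^+ 2 - v)) + (a + 2 * b * (x - v)) * y + b * y ^+ 2.
Proof. by rewrite /charlier; ring. Qed.

Lemma integrable_pf_quadratic a b c u : 0 <= u ->
  P.-integrable [set: T]
    (EFin \o (fun w => a + b * (N u w)%:R + c * (N u w)%:R ^+ 2)).
Proof.
rewrite le_eqVlt => /predU1P[<-|u0].
  apply: eq_integrable (finite_measure_integrable_cst P a measurableT) => //.
  by move=> w _ /=; rewrite (pf0 GN) mulr0 expr2 !mulr0 !addr0.
have NE w : N u w = (N u w - N 0 w)%N by rewrite (pf0 GN) subn0.
apply: (@integrable_poisson_quadratic _ _ _ P (u - 0)) => //.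
- by rewrite subr0.
- by move=> k; apply: pf_measurable_eq; exact: ltW.
- move=> k; rewrite -(pf_increment GN)//; last first.
    by have [/(_ 0 (lexx _))/sigma_algebra_setT] := pf_filtration GN.
  by congr (P (_ `&` _)); apply/seteqP; split => w /=; rewrite -NE.
Qed.

Lemma integrable_charlier a b u : 0 <= u ->
  P.-integrable [set: T] (EFin \o (fun w => charlier a b u (N u w)%:R)).
Proof.
move=> u0.
apply: eq_integrable (integrable_pf_quadratic (a * (- u) + b * (u ^+ 2 - u))
  (a + 2 * b * (- u)) b u0) => //.
by move=> w _ /=; congr EFin; rewrite /charlier; ring.
Qed.

(** Split [B] by the value [k] of [N u]. On each piece the left integrand is a quadratic in an
    increment independent of the piece, and its Poisson mean is [charlier a b u k]. *)
Lemma charlier_mart a b u v B : 0 <= u -> u <= v -> G u B ->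
  (\int[P]_(w in B) (charlier a b v (N v w)%:R)%:E =
   \int[P]_(w in B) (charlier a b u (N u w)%:R)%:E)%E.
Proof.
move=> u0; rewrite le_eqVlt => /predU1P[<-//|uv] GB.
have mB := pf_measurable u0 GB.
have v0 : 0 <= v by rewrite (le_trans u0)// ltW.
pose Bk k := B `&` [set w | N u w = k].
have GBk k : G u (Bk k).
  have [/(_ u u0) sG _ _] := pf_filtration GN.
  by apply: sigma_algebra_setI => //; exact: (pf_adapted GN).
have mBk k : measurable (Bk k) by exact: (pf_measurable u0).
have BE : B = \bigcup_k Bk k.
  by apply/seteqP; split => [w Bw|w [k _ []]//]; exists (N u w).
have tB : trivIset [set: nat] Bk by move=> i j _ _ [w [[_ /= <-] [_ /= <-]]].
have iS s : 0 <= s ->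
    P.-integrable (\bigcup_k Bk k) (fun w => (charlier a b s (N s w)%:R)%:E).
  move=> s0; apply: integrableS (integrable_charlier a b s0) => //.
  by rewrite -BE.
rewrite BE !integral_bigcup//; [|exact: iS|exact: iS].
apply: eq_eseriesr => k _.
have vu0 : 0 < v - u by rewrite subr_gt0.
have mY j : measurable [set w | (N v w - N u w)%N = j].
  by apply: pf_measurable_increment => //; exact: ltW.
have BY j := pf_increment GN j u0 uv (GBk k).
rewrite [RHS](_ : _ = (fine (P (Bk k)) * charlier a b u k%:R)%:E); last first.
  rewrite (eq_integral (cst (charlier a b u k%:R)%:E)); last first.
    by move=> w; rewrite inE => -[_ /= ->].
  by rewrite integral_cst// muleC EFinM fineK// fin_num_measure.
rewrite (eq_integral (fun w => (a * (k%:R - v) + b * ((k%:R - v) ^+ 2 - v) +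
    (a + 2 * b * (k%:R - v)) * (N v w - N u w)%N%:R +
    b * (N v w - N u w)%N%:R ^+ 2)%:E)); last first.
  move=> w; rewrite inE => -[_ /= Nk]; congr EFin.
  rewrite -charlier_increment// -natrD; congr (charlier _ _ _ _%:R).
  by rewrite -Nk subnKC// (pf_nondecreasing GN)// ltW.
rewrite -[LHS]fineK; last first.
  apply: integrable_fin_num => //; exact: (integrable_poisson_quadratic vu0).
congr EFin; rewrite [LHS](Rintegral_poisson_quadratic vu0)// /charlier.
by congr (_ * _); ring.
Qed.

End charlier_martingale.

(** * One-sided neighborhoods and discretization from above *)

Section one_sided_neighborhoods.
Context {R : realType}.
Implicit Types (x : R) (Q : R -> Prop).

Lemma at_rightE x Q : (\forall s \near x^'+, Q s) <->
  exists2 e, 0 < e & forall s, x < s -> s < x + e -> Q s.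
Proof.
split=> [/nbhs_ballP[e /= e0 xQ]|[e e0 xQ]].
  exists e => // s xs sxe; apply: xQ => //=.
  by rewrite /ball/= distrC ger0_norm ?subr_ge0 1?ltW// ltrBlDl.
near=> s; apply: xQ; near: s; first exact: nbhs_right_gt.
by apply: nbhs_right_lt; rewrite ltrDl.
Unshelve. all: by end_near. Qed.

Lemma at_leftE x Q : (\forall s \near x^'-, Q s) <->
  exists2 e, 0 < e & forall s, x - e < s -> s < x -> Q s.
Proof.
split=> [/nbhs_ballP[e /= e0 xQ]|[e e0 xQ]].
  exists e => // s xs sxe; apply: xQ => //=.
  by rewrite /ball/= ger0_norm ?subr_ge0 1?ltW// ltrBlDl -ltrBlDr.
near=> s; apply: xQ; near: s; last exact: nbhs_left_lt.
by apply: nbhs_left_gt; rewrite ltrBlDr ltrDl.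
Unshelve. all: by end_near. Qed.

End one_sided_neighborhoods.

Section grid.
Context {R : realType}.
Implicit Types (c x : R).

Definition ceiln x : nat := `|Num.ceil x|%N.

Lemma ceiln_le x k : 0 <= x -> (ceiln x <= k)%N = (x <= k%:R).
Proof.
move=> x0; rewrite -lez_nat /ceiln gez0_abs ?ceil_le_int//.
by rewrite ceil_ge0 (lt_le_trans _ x0).
Qed.

Lemma ceiln_itv x : 0 <= x -> x <= (ceiln x)%:R < x + 1.
Proof.
move=> x0; have c0 : 0 <= Num.ceil x by rewrite ceil_ge0 (lt_le_trans _ x0).
have /andP[] := ceil_itv x; rewrite /ceiln natr_absz ger0_norm// => h1 h2.
by rewrite h2 -ltrBlDr -[1]/(1%:~R) -intrB.
Qed.

(** The classical approximation of a stopping time from above by one with discrete values, here of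
    mesh [1 / m.+1]. The cap at [c] keeps it in the range where a single dominating function
    works. *)
Definition grid c (m : nat) x : R :=
  Num.min c ((ceiln (m.+1%:R * x))%:R / m.+1%:R).

Lemma grid_ge c m x : 0 <= x -> x <= c -> x <= grid c m x.
Proof.
move=> x0 xc; rewrite /grid le_min xc/= ler_pdivlMr// mulrC.
by have /andP[] := @ceiln_itv (m.+1%:R * x) (mulr_ge0 (ler0n _ _) x0).
Qed.

Lemma grid_le c m x : grid c m x <= c.
Proof. by rewrite /grid ge_min lexx. Qed.

Lemma grid_lt c m x : 0 <= x -> grid c m x < x + m.+1%:R^-1.
Proof.
move=> x0; rewrite /grid gt_min ltr_pdivrMr// mulrDl mulVf//.
have /andP[_] := @ceiln_itv (m.+1%:R * x) (mulr_ge0 (ler0n _ _) x0).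
by rewrite [x * _]mulrC => ->; rewrite orbT.
Qed.

Lemma cvg_grid c x : 0 <= x -> x <= c -> grid c m x @[m --> \oo] --> x.
Proof.
move=> x0 xc; apply: (@squeeze_cvgr _ _ _ _ (cst x) (fun m => x + m.+1%:R^-1)).
- by near=> m; rewrite grid_ge//= ltW// grid_lt.
- exact: cvg_cst.
- by rewrite -[X in _ --> X]addr0; apply: cvgD; [exact: cvg_cst|exact: cvg_harmonic].
Unshelve. all: by end_near. Qed.

End grid.

(** * Optional stopping at a bounded random level *)

Section optional_stopping.
Context {d : measure_display} {T : measurableType d} {R : realType}.
Variable P : probability T R.
Variables (G : R -> set (set T)) (N : R -> T -> nat).
Hypothesis GN : poisson_in_filtration P G N.
Variables (a b c : R).
Hypothesis c0 : 0 <= c.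

(** As [N] is nondecreasing, its value at [c] controls [charlier] at all levels [u <= c] at once;
    the second Poisson moment makes this bound integrable. *)
Let dom (w : T) : R :=
  `|a| * ((N c w)%:R + c) + `|b| * (((N c w)%:R + c) ^+ 2 + c).

Lemma charlier_le_dom u w : 0 <= u -> u <= c ->
  `|charlier a b u (N u w)%:R| <= dom w.
Proof.
move=> u0 uc; rewrite /charlier (le_trans (ler_normD _ _))// !normrM.
have Nu : (N u w)%:R <= (N c w)%:R :> R by rewrite ler_nat (pf_nondecreasing GN).
have h : `|(N u w)%:R - u| <= (N c w)%:R + c.
  by rewrite (le_trans (ler_normB _ _))// lerD// ger0_norm.
rewrite lerD ?ler_wpM2l// (le_trans (ler_normB _ _))// lerD//; last by rewrite ger0_norm.
by rewrite normrX lerXn2r ?nnegrE// addr_ge0.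
Qed.

Lemma integrable_dom : P.-integrable [set: T] (EFin \o dom).
Proof.
apply: eq_integrable (integrable_pf_quadratic GN
  (`|a| * c + `|b| * (c ^+ 2 + c)) (`|a| + `|b| * (2 * c)) `|b| c0) => //.
by move=> w _ /=; congr EFin; rewrite /dom; ring.
Qed.

Lemma cvg_charlier_right (s : nat -> R) u w : 0 <= u -> (forall m, u <= s m) ->
  s m @[m --> \oo] --> u ->
  charlier a b (s m) (N (s m) w)%:R @[m --> \oo] --> charlier a b u (N u w)%:R.
Proof.
move=> u0 us su.
have /at_rightE[e e0 Ne] := pf_right_continuous GN w u0.
have : charlier a b (s m) (N u w)%:R @[m --> \oo] --> charlier a b u (N u w)%:R.
  have h : (N u w)%:R - s m @[m --> \oo] --> (N u w)%:R - u.
    by apply: cvgB => //; exact: cvg_cst.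
  rewrite /charlier; apply: cvgD; apply: cvgM; [exact: cvg_cst|exact: h|exact: cvg_cst|].
  apply: cvgB => //; rewrite expr2; under eq_fun do rewrite expr2.
  exact: cvgM.
apply: cvg_trans; apply: near_eq_cvg; near=> m.
have : s m < u + e by near: m; apply: (cvgr_lt u) => //; rewrite ltrDl.
have := us m; rewrite le_eqVlt => /predU1P[<-//|um] sme.
by rewrite Ne.
Unshelve. all: by end_near. Qed.

Variables (tau : T -> R) (B : set T).
Hypothesis tau0 : forall w, 0 <= tau w.
Hypothesis tauc : forall w, tau w <= c.
(** This places [B] in the stopped sigma-algebra at [tau]. All integrals are over [B], so the
    stopping property of [tau] is tested within [B] only. *)
Hypothesis Btau : forall u, 0 <= u -> G u (B `&` [set w | tau w <= u]).

Let GB : G c B.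
Proof.
have := Btau c0; rewrite (_ : _ `&` _ = B)//.
by apply/seteqP; split => [w []//|w Bw]; split => //=.
Qed.

Let mB : measurable B := pf_measurable GN c0 GB.

Let Bm m j := B `&` [set w | ceiln (m.+1%:R * tau w) = j].

Let sG u : 0 <= u -> sigma_algebra [set: T] (G u).
Proof. by move=> u0; have [+ _ _] := pf_filtration GN; apply. Qed.

Let Gle m j u : 0 <= u -> u = Num.min c (j%:R / m.+1%:R) ->
  G u (B `&` [set w | (ceiln (m.+1%:R * tau w) <= j)%N]).
Proof.
move=> u0 uE.
rewrite (_ : _ `&` _ = B `&` [set w | tau w <= u]); first exact: Btau.
apply/seteqP; split => w [Bw /=].
  rewrite ceiln_le ?mulr_ge0// -ler_pdivlMl// => h; split => //=.
  by rewrite uE le_min tauc/= mulrC.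
by rewrite uE le_min tauc/= => h; split => //=;
  rewrite ceiln_le ?mulr_ge0// -ler_pdivlMl// mulrC.
Qed.

(** On [Bm m j] the discretized level equals [min c (j / m.+1)], and the event is decided at that
    very level, being a difference of two events treated in [Gle]. *)
Let GBm m j : G (Num.min c (j%:R / m.+1%:R)) (Bm m j).
Proof.
have mn0 i : 0 <= Num.min c (i%:R / m.+1%:R) by rewrite le_min c0/= divr_ge0.
case: j => [|j].
  rewrite (_ : Bm m 0 = B `&` [set w | (ceiln (m.+1%:R * tau w) <= 0)%N]); last first.
    apply/seteqP; split => w [Bw /= h]; split => //=; first by rewrite h.
    by apply/eqP; rewrite -leqn0.
  exact: Gle.
rewrite (_ : Bm m j.+1 = (B `&` [set w | (ceiln (m.+1%:R * tau w) <= j.+1)%N]) `&`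
   ~` (B `&` [set w | (ceiln (m.+1%:R * tau w) <= j)%N])); last first.
  apply/seteqP; split => w.
    by move=> [Bw /= ->]; split => //= -[_]; rewrite ltnn.
  move=> [[Bw /= h] nh]; split => //=; apply/eqP.
  by rewrite eqn_leq h ltnNge; apply/negP => h'; apply: nh.
apply: sigma_algebra_setI; [exact: sG|exact: Gle|].
apply: sigma_algebra_setC; first exact: sG.
apply: (pf_mono GN (mn0 j)); last exact: Gle.
by rewrite le_min ge_min lexx/= ge_min; apply/orP; right; rewrite ler_pM2r// ler_nat.
Qed.

Let taum m w := grid c m (tau w).

Let mBm m j : measurable (Bm m j).
Proof. by apply: (pf_measurable GN _ (GBm m j)); rewrite le_min c0/= divr_ge0. Qed.

Let BE m : B = \bigcup_j Bm m j.
Proof.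
apply/seteqP; split => [w Bw|w [k _ []]//].
by exists (ceiln (m.+1%:R * tau w)).
Qed.

Let taumE m j w : Bm m j w -> taum m w = Num.min c (j%:R / m.+1%:R).
Proof. by move=> [_ /= <-]. Qed.

Let taum0 m w : 0 <= taum m w.
Proof. by rewrite (le_trans (tau0 w))// grid_ge. Qed.

Let measurable_charlier_taum m :
  measurable_fun B (fun w => (charlier a b (taum m w) (N (taum m w) w)%:R)%:E).
Proof.
rewrite (BE m); apply/measurable_fun_bigcup => // j.
set u := Num.min c (j%:R / m.+1%:R).
have u0 : 0 <= u by rewrite le_min c0/= divr_ge0.
apply: (eq_measurable_fun (fun w => (charlier a b u (N u w)%:R)%:E)).
  by move=> w; rewrite inE => /taumE ->.
apply: measurable_funTS; exact: measurable_int (integrable_charlier GN a b u0).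
Qed.

Let integral_charlier_taum m :
  (\int[P]_(w in B) (charlier a b (taum m w) (N (taum m w) w)%:R)%:E =
   \int[P]_(w in B) (charlier a b c (N c w)%:R)%:E)%E.
Proof.
have tB : trivIset [set: nat] (Bm m) by move=> i j _ _ [w [[_ /= <-] [_ /= <-]]].
rewrite (BE m) !integral_bigcup//.
- apply: eq_eseriesr => j _.
  set u := Num.min c (j%:R / m.+1%:R).
  have u0 : 0 <= u by rewrite le_min c0/= divr_ge0.
  have uc : u <= c by rewrite ge_min lexx.
  rewrite (eq_integral (fun w => (charlier a b u (N u w)%:R)%:E)).
    by rewrite -(charlier_mart GN a b u0 uc (GBm m j)).
  by move=> w; rewrite inE => /taumE ->.
- rewrite -BE; apply: integrableS (integrable_charlier GN a b c0) => //.
- rewrite -BE; apply: (le_integrable mB (g := EFin \o dom)).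
  + exact: measurable_charlier_taum.
  + move=> w Bw /=; rewrite lee_fin [leRHS]ger0_norm; last first.
      exact: le_trans (normr_ge0 _) (charlier_le_dom w c0 (lexx _)).
    by rewrite charlier_le_dom// grid_le.
  + by apply: integrableS integrable_dom.
Qed.

(** For the discretized level, sum the identity of [charlier_mart] over the pieces where that level
    is constant. Then refine the mesh: the levels decrease to [tau] from above, where [N] is
    right-continuous, and [dom] dominates. *)
Lemma charlier_optional_stopping :
  P.-integrable B (fun w => (charlier a b (tau w) (N (tau w) w)%:R)%:E) /\
  (\int[P]_(w in B) (charlier a b (tau w) (N (tau w) w)%:R)%:E =
   \int[P]_(w in B) (charlier a b c (N c w)%:R)%:E)%E.
Proof.
have cv w : B w -> (charlier a b (taum m w) (N (taum m w) w)%:R)%:E @[m --> \oo] -->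
    (charlier a b (tau w) (N (tau w) w)%:R)%:E.
  move=> Bw; apply: cvg_EFin; first by near=> m.
  apply: cvg_charlier_right => //.
  - by move=> m; rewrite grid_ge.
  - exact: cvg_grid.
have [] := @dominated_convergence _ _ _ P B mB
  (fun m w => (charlier a b (taum m w) (N (taum m w) w)%:R)%:E)
  (fun w => (charlier a b (tau w) (N (tau w) w)%:R)%:E) (EFin \o dom).
- exact: measurable_charlier_taum.
- exact: emeasurable_fun_cvg measurable_charlier_taum cv.
- exact: aeW.
- exact: integrableS integrable_dom.
- apply: aeW => w m Bw /=; rewrite lee_fin; apply: charlier_le_dom => //; exact: grid_le.
move=> itau _ lim; split => //.
apply/esym; apply: cvg_unique lim => //=.
under eq_fun do rewrite integral_charlier_taum.
exact: cvg_cst.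
Unshelve. all: by end_near. Qed.

End optional_stopping.

(** * Random time change *)

Section nondecreasing_nat_paths.
Context {R : realType}.

(** The values taken before [t] are bounded by [f t], so they have a maximum, attained at some
    [r < t]; from [r] on the path cannot leave it before [t]. *)
Lemma nondecreasing_nat_left_const (f : R -> nat) t : 0 < t ->
  (forall r s, 0 <= r -> r <= s -> (f r <= f s)%N) ->
  exists k, \forall s \near t^'-, f s = k.
Proof.
move=> t0 fnd; pose Q k := `[< exists2 s, 0 <= s < t & f s = k >].
have exQ : exists k, Q k by exists (f 0); apply/asboolP; exists 0; rewrite ?lexx.
have Qle k : Q k -> (k <= f t)%N.
  by move=> /asboolP[s /andP[s0 st] <-]; rewrite fnd// ltW.
case: (ex_maxnP exQ Qle) => k /asboolP[r /andP[r0 rt] fr] kmax; exists k.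
near=> s; have rs : r < s by near: s; exact: nbhs_left_gt.
have st : s < t by near: s; exact: nbhs_left_lt.
apply/eqP; rewrite eqn_leq -{2}fr fnd// ?ltW// andbT; apply: kmax.
by apply/asboolP; exists s => //; rewrite st (le_trans r0)// ltW.
Unshelve. all: by end_near. Qed.

End nondecreasing_nat_paths.

Section integral_exhaustion.
Context {d : measure_display} {T : measurableType d} {R : realType}.
Variable P : {measure set T -> \bar R}.

Lemma cvg_integral_eventually (B : set T) (E : (set T)^nat) (X : T -> \bar R) :
  measurable B -> (forall n, measurable (E n)) -> P.-integrable B X ->
  (forall w, \forall n \near \oo, E n w) ->
  (\int[P]_(w in B `&` E n) X w @[n --> \oo] --> \int[P]_(w in B) X w)%E.
Proof.
move=> mB mE iX evE; under eq_fun do rewrite integral_mkcondr.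
have mX := measurable_int _ iX.
have [//|||||] := @dominated_convergence _ _ _ P B mB
   (fun n => X \_ (E n)) X (abse \o X).
- move=> n; apply/(measurable_restrict X (mE n) mB).
  by apply: measurable_funS mX => //; exact: subIsetl.
- exact: mX.
- apply: aeW => w Bw; apply: cvg_near_cst; near=> n.
  by rewrite patchE ifT// inE; near: n.
- exact: integrable_abse.
- apply: aeW => w n Bw /=; rewrite patchE; case: ifPn => // _.
  by rewrite abse0 abse_ge0.
- by [].
Unshelve. all: by end_near. Qed.

Lemma cvg_integral_eventually_not (B : set T) (E : (set T)^nat) (X : T -> \bar R) :
  measurable B -> (forall n, measurable (E n)) -> P.-integrable B X ->
  (forall w, \forall n \near \oo, ~ E n w) ->
  (\int[P]_(w in B `&` E n) X w @[n --> \oo] --> 0)%E.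
Proof.
move=> mB mE iX evE; under eq_fun do rewrite integral_mkcondr.
have mX := measurable_int _ iX.
have [//|||||_ _] := @dominated_convergence _ _ _ P B mB
   (fun n => X \_ (E n)) (cst 0%E) (abse \o X).
- move=> n; apply/(measurable_restrict X (mE n) mB).
  by apply: measurable_funS mX => //; exact: subIsetl.
- exact: measurable_cst.
- apply: aeW => w Bw; apply: cvg_near_cst; near=> n.
  by rewrite patchE ifF//; apply/negbTE; rewrite notin_setE; near: n.
- exact: integrable_abse.
- apply: aeW => w n Bw /=; rewrite patchE; case: ifPn => // _.
  by rewrite abse0 abse_ge0.
- by rewrite integral0.
Unshelve. all: by end_near. Qed.

End integral_exhaustion.

Section time_change.
Context {d : measure_display} {T : measurableType d} {R : realType}.
Variable P : probability T R.

(** [clk_past] says at once that [C t] is a stopping time of [G] (take [B] to be everything) and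
    that [F t] lies in the stopped sigma-algebra at [C t]. [clk_bound_past] makes the bound [K t]
    known at level 0, hence independent of [N]. The clock is continuous, so all jumps of [N (C t)]
    come from [N]. *)
Record clock_for (G : R -> set (set T)) (N : R -> T -> nat)
    (F : R -> set (set T)) (C K : R -> T -> R) : Prop := ClockFor {
  clk_filtration : filtration F ;
  clk0 : forall w, C 0 w = 0 ;
  clk_nondecreasing : forall w s t, 0 <= s -> s <= t -> C s w <= C t w ;
  clk_right : forall w t, 0 <= t -> C s w @[s --> t^'+] --> C t w ;
  clk_left : forall w t, 0 < t -> C s w @[s --> t^'-] --> C t w ;
  clk_le : forall w t, 0 <= t -> C t w <= K t w ;
  clk_bound_integrable : forall t, 0 <= t -> P.-integrable [set: T] (EFin \o K t) ;
  clk_bound_past : forall t c, 0 <= t -> G 0 [set w | c < K t w] ;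
  clk_past : forall t u B, 0 <= t -> 0 <= u -> F t B ->
    G u (B `&` [set w | C t w <= u]) ;
  clk_adapted : adapted F C ;
  clk_count_adapted : forall t k, 0 <= t -> F t [set w | N (C t w) w = k]
}.

Variables (G : R -> set (set T)) (N : R -> T -> nat).
Variables (F : R -> set (set T)) (C K : R -> T -> R).
Hypothesis GN : poisson_in_filtration P G N.
Hypothesis CK : clock_for G N F C K.
Implicit Types (s t : R).

Let D t w : nat := N (C t w) w.

Definition time_changed a b t w : R := charlier a b (C t w) (N (C t w) w)%:R.

Lemma clk_ge0 t w : 0 <= t -> 0 <= C t w.
Proof. by move=> t0; rewrite -(clk0 CK w) (clk_nondecreasing CK). Qed.

Let sF t : 0 <= t -> sigma_algebra [set: T] (F t).
Proof. by move=> t0; have [+ _ _] := clk_filtration CK; apply. Qed.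

Let sG t : 0 <= t -> sigma_algebra [set: T] (G t).
Proof. by move=> t0; have [+ _ _] := pf_filtration GN; apply. Qed.

Let F_measurable t B : 0 <= t -> F t B -> measurable B.
Proof. by move=> t0; have [_ + _] := clk_filtration CK; apply. Qed.

Lemma clk_measurable t : 0 <= t -> measurable_fun [set: T] (C t).
Proof.
move=> t0 _ U mU; rewrite setTI; apply: (F_measurable t0).
exact: (clk_adapted CK).
Qed.

Lemma clk_count_measurable t : 0 <= t -> measurable_fun [set: T] (D t).
Proof.
move=> t0; apply: measurable_nat_fun => k; apply: (F_measurable t0).
exact: (clk_count_adapted CK).
Qed.

Lemma measurable_time_changed a b t : 0 <= t ->
  measurable_fun [set: T] (time_changed a b t).
Proof.
move=> t0; have mC := clk_measurable t0.
have mD : measurable_fun [set: T] (fun w => (D t w)%:R : R).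
  apply: (measurableT_comp (f := fun k => k%:R : R)) => //.
  exact: clk_count_measurable.
rewrite /time_changed /charlier; apply: measurable_funD.
  by apply: measurable_funM => //; exact: measurable_funB.
apply: measurable_funM => //; apply: measurable_funB => //.
by apply: measurable_funX; exact: measurable_funB.
Qed.

Lemma clk_integrable t : 0 <= t -> P.-integrable [set: T] (EFin \o C t).
Proof.
move=> t0; apply: (le_integrable measurableT _ _ (clk_bound_integrable CK t0)).
  exact/measurable_EFinP/clk_measurable.
move=> w _ /=; rewrite lee_fin ger0_norm ?clk_ge0//.
by rewrite (le_trans (clk_le CK w t0))// ler_norm.
Qed.

(** [B] is visible to [G] only once the level has passed [C s], hence the restriction to
    [{C s <= c}]. If [c <= u], the cap makes the condition on [C t] void; if [u < c], the condition
    reads [C t <= u] and forces [C s <= c] by monotonicity. *)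
Let stopped_past s t c u B : 0 <= s -> s <= t -> 0 <= c -> 0 <= u -> F s B ->
  G u ((B `&` [set w | C s w <= c]) `&` [set w | Num.min c (C t w) <= u]).
Proof.
move=> s0 st c0 u0 FB; have t0 := le_trans s0 st; have [cu|uc] := leP c u.
  rewrite (_ : _ `&` _ = B `&` [set w | C s w <= c]).
    by apply: (pf_mono GN c0 cu); exact: (clk_past CK).
  apply/seteqP; split => w; first by case.
  by move=> h; split => //=; rewrite ge_min cu.
rewrite (_ : _ `&` _ = B `&` [set w | C t w <= u]).
  apply: (clk_past CK) => //.
  by have [_ _ /(_ s t s0 st)] := clk_filtration CK; apply.
apply/seteqP; split => w /=.
  by move=> [[Bw _]]; rewrite ge_min leNgt uc/= => ?; split.
move=> [Bw Ct]; split; last by rewrite ge_min Ct orbT.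
by split => //; rewrite (le_trans (clk_nondecreasing CK w s0 st))// (le_trans Ct)// ltW.
Qed.

Let min0 c t w : 0 <= c -> 0 <= t -> 0 <= Num.min c (C t w).
Proof. by move=> c0 t0; rewrite le_min c0 clk_ge0. Qed.

Let OS a b s t c B : 0 <= s -> s <= t -> 0 <= c -> F s B ->
  let Z w := (charlier a b (Num.min c (C t w)) (N (Num.min c (C t w)) w)%:R)%:E in
  P.-integrable (B `&` [set w | C s w <= c]) Z /\
  (\int[P]_(w in B `&` [set w | (C s w <= c)%R]) Z w =
   \int[P]_(w in B `&` [set w | (C s w <= c)%R]) (charlier a b c (N c w)%:R)%:E)%E.
Proof.
move=> s0 st c0 FB Z; have t0 := le_trans s0 st.
apply: (charlier_optional_stopping GN) => //.
- by move=> w; exact: min0.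
- by move=> w; rewrite ge_min lexx.
- by move=> u u0; exact: stopped_past.
Qed.

Let FT t : 0 <= t -> F t [set: T].
Proof. by move=> t0; apply: sigma_algebra_setT; exact: sF. Qed.

(** On [{C t <= n}] the stopped and the unstopped values agree, so the second moment there is at
    most the mean of [min n (C t)], hence at most that of [K t]. This bound is free of [n], and
    monotone convergence removes the restriction. *)
Lemma time_changed_second_moment t : 0 <= t ->
  (\int[P]_w (((D t w)%:R - C t w) ^+ 2)%:E < +oo)%E.
Proof.
move=> t0; have iC := clk_integrable t0.
have iK := clk_bound_integrable CK t0.
pose X w := ((D t w)%:R - C t w) ^+ 2.
have XE : X = fun w => (time_changed 1 0 t w) ^+ 2.
  by apply/funext => w; rewrite /X /time_changed /charlier mul1r mul0r addr0.
have mX : measurable_fun [set: T] X.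
  by rewrite XE; apply: measurable_funX; exact: measurable_time_changed.
have bound (n : nat) :
    (\int[P]_(w in [set w | (C t w <= n%:R)%R]) (X w)%:E <=
     \int[P]_w (K t w)%:E)%E.
  have n0 : 0 <= n%:R :> R by [].
  have TC0 : [set: T] `&` [set w | C 0 w <= n%:R] = [set: T].
    by rewrite setTI; apply/seteqP; split => // w _ /=; rewrite (clk0 CK).
  (* Wald's second identity: with coefficients [(0, 1)] the value at level [n] has mean zero, so the
     squared stopped value and the stopped level have the same mean. *)
  have [] := OS 0 1 (lexx _) t0 n0 (FT (lexx _)).
  rewrite TC0 => iZ Zeq.
  have L0 : (\int[P]_w (charlier 0 1 n%:R (N n%:R w)%:R)%:E = 0)%E.
    rewrite (charlier_mart GN 0 1 (lexx _) n0 (sigma_algebra_setT (sG (lexx _)))).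
    under eq_integral do rewrite (pf0 GN) /charlier !subr0 mul0r expr2 mul0r mulr0 addr0.
    exact: integral0.
  pose tau w := Num.min n%:R (C t w).
  have mtau : measurable_fun [set: T] tau.
    by apply: measurable_minr => //; exact: clk_measurable.
  have itau : P.-integrable [set: T] (EFin \o tau).
    apply: (le_integrable measurableT _ _ iC); first exact/measurable_EFinP.
    move=> w _ /=; rewrite lee_fin ger0_norm ?min0// ger0_norm ?clk_ge0//.
    by rewrite ge_min lexx orbT.
  pose Y w := ((N (tau w) w)%:R - tau w) ^+ 2.
  have YE : EFin \o Y = (fun w => ((charlier 0 1 (tau w) (N (tau w) w)%:R)%:E +
      (EFin \o tau) w)%E).
    by apply/funext => w /=; rewrite -EFinD /Y /charlier mul0r add0r mul1r subrK.
  have iY : P.-integrable [set: T] (EFin \o Y).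
    by rewrite YE; exact: (integrableD measurableT iZ itau).
  have intY : (\int[P]_w (Y w)%:E = \int[P]_w (tau w)%:E)%E.
    rewrite -[LHS]/(\int[P]_w (EFin \o Y) w)%E YE.
    by rewrite (integralD measurableT iZ itau) Zeq L0 add0e.
  have mE : measurable [set w | (C t w <= n%:R)%R].
    rewrite -[X in measurable X]setTI -preimage_itvNyc; exact: clk_measurable.
  rewrite (eq_integral (EFin \o Y)); last first.
    by move=> w; rewrite inE /= => Cn; rewrite /X /Y /tau min_r.
  apply: (@le_trans _ _ (\int[P]_w (Y w)%:E)%E).
    apply: ge0_subset_integral => //; first exact: measurable_int iY.
    by move=> w _; rewrite lee_fin sqr_ge0.
  rewrite intY; apply: le_integral => //.
  by move=> w _; rewrite lee_fin ge_min (clk_le CK)// orbT.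
have cv : (\int[P]_(w in [set w | (C t w <= n%:R)%R]) (X w)%:E @[n --> \oo] -->
    \int[P]_w (X w)%:E)%E.
  have <- : \bigcup_n [set w | (C t w <= n%:R)%R] = [set: T].
    apply/seteqP; split => // w _; exists (Num.bound (C t w)) => //=.
    by rewrite ltW// archi_boundP// clk_ge0.
  apply: ge0_nondecreasing_set_cvg_integral => //.
  - move=> m n mn; apply/subsetPset => w /= /le_trans; apply.
    by rewrite ler_nat.
  - by move=> n; rewrite -[X in measurable X]setTI -preimage_itvNyc;
      exact: clk_measurable.
  - by move=> n; apply/measurable_EFinP; exact: measurable_funTS.
  - by move=> n w _; rewrite lee_fin sqr_ge0.
rewrite -(cvg_lim _ cv)//; apply: (@le_lt_trans _ _ (\int[P]_w (K t w)%:E)%E).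
  by apply: lime_le; [apply/cvg_ex; eexists; exact: cv|exact: nearW].
exact: integrable_lty.
Qed.

Lemma time_changed_square_integrable t : 0 <= t ->
  P.-integrable [set: T] (fun w => (((D t w)%:R - C t w) ^+ 2)%:E).
Proof.
move=> t0; apply/integrableP; split.
  apply/measurable_EFinP/measurable_funX.
  apply: (eq_measurable_fun (time_changed 1 0 t)); last exact: measurable_time_changed.
  by move=> w _; rewrite /time_changed /charlier mul1r mul0r addr0.
under eq_integral do rewrite gee0_abs ?lee_fin ?sqr_ge0//.
exact: time_changed_second_moment.
Qed.

Lemma time_changed_integrable a b t : 0 <= t ->
  P.-integrable [set: T] (EFin \o time_changed a b t).
Proof.
move=> t0; have iC := clk_integrable t0.
have iX2 := time_changed_square_integrable t0.
have i1 := finite_measure_integrable_cst P 1 measurableT.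
have iX : P.-integrable [set: T] (EFin \o time_changed 1 0 t).
  apply: (le_integrable measurableT _ _ (integrableD measurableT i1 iX2)).
    exact/measurable_EFinP/measurable_time_changed.
  move=> w _ /=; rewrite lee_fin /time_changed /charlier mul1r mul0r addr0.
  rewrite -/(D t w); set x := _ - _; rewrite [leRHS]ger0_norm ?addr_ge0 ?sqr_ge0//.
  (* Expanding [(|x| - 1) ^+ 2 >= 0] gives [2 |x| <= 1 + x ^+ 2], so square integrability yields
     integrability. *)
  have := sqr_ge0 (`|x| - 1); rewrite sqrrB1 real_normK ?num_real//.
  by have := normr_ge0 x; lra.
apply: eq_integrable (integrableD measurableT (integrableZl measurableT a iX)
  (integrableZl measurableT b (integrableB measurableT iX2 iC))) => //.
move=> w _ /=; rewrite -EFinM -EFinB -EFinM -EFinD; congr EFin.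
by rewrite /time_changed /charlier /D; ring.
Qed.

(* On [E n] the stopped value is [charlier a b n (N n)]; as [K t] belongs to the
   past of time 0 its mean over [{K t > n}] is at most [const * n * P (K t > n)]. *)
Let remainder a b t (E : (set T)^nat) : 0 <= t -> (forall n, measurable (E n)) ->
  (forall n, E n `<=` [set w | n%:R < K t w]) ->
  (\int[P]_(w in E n) (charlier a b n%:R (N n%:R w)%:R)%:E @[n --> \oo] --> 0)%E.
Proof.
move=> t0 mE EK; pose k : R := 2 * `|a| + 2 * `|b|.
have iK := clk_bound_integrable CK t0.
have GK c : G 0 [set w | c < K t w] by exact: (clk_bound_past CK).
have mK c : measurable [set w | c < K t w] by exact: (pf_measurable GN _ (GK c)).
have k0 : 0 <= k by rewrite addr_ge0// mulr_ge0.
(* The triangle-inequality majorant of the absolute value of [charlier], expanded as a quadratic in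
   [N n]. Since [N n] has mean and variance [n], the mean of [q n] is [2 |a| n + 2 |b| n = k * n]:
   linear in [n], although its terms are quadratic. *)
pose q n w : R := (`|a| * n%:R + `|b| * (n%:R ^+ 2 + n%:R)) +
  (`|a| - `|b| * (2 * n%:R)) * (N n%:R w)%:R + `|b| * (N n%:R w)%:R ^+ 2.
have qE n w : q n w = `|a| * ((N n%:R w)%:R + n%:R) +
    `|b| * (((N n%:R w)%:R - n%:R) ^+ 2 + n%:R) by rewrite /q; ring.
have iq n : P.-integrable [set: T] (EFin \o q n).
  exact: (integrable_pf_quadratic GN).
have lim0 : (k%:E * \int[P]_(w in [set w | (n%:R < K t w)%R]) (K t w)%:E
    @[n --> \oo] --> 0)%E.
  rewrite -(mule0 k%:E); apply: cvgeZl => //.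
  under eq_fun do rewrite -[X in integral _ X _]setTI.
  apply: (cvg_integral_eventually_not (E := fun n => [set w | n%:R < K t w])) => //.
  move=> w; near=> n => /=; apply/negP; rewrite -leNgt (le_trans (ler_norm _))//.
  by near: n; exact: nbhs_infty_ger.
apply/cvg_abse0P; apply: (squeeze_cvge _ (cvg_cst 0%E) lim0).
near=> n; rewrite abse_ge0/=.
have n0 : 0 < n%:R :> R by rewrite ltr0n; near: n; exact: nbhs_infty_gt.
have iL := integrable_charlier GN a b (ltW n0).
have mL D := measurable_funTS (measurable_int _ iL) (D := D).
apply: (le_trans (le_abse_integral _ _ _)) => //.
apply: (@le_trans _ _ (\int[P]_(w in E n) (q n w)%:E)%E).
  apply: ge0_le_integral => //.
  - by apply: measurableT_comp => //; exact: mL.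
  - by apply: measurable_funTS; exact: measurable_int (iq n).
  - move=> w Ew /=; rewrite lee_fin qE /charlier (le_trans (ler_normD _ _))//.
    rewrite !normrM lerD// ler_wpM2l//.
      by rewrite (le_trans (ler_normB _ _))// !ger0_norm.
    by rewrite (le_trans (ler_normB _ _))// normrX real_normK ?num_real// (ger0_norm (ltW n0)).
apply: (@le_trans _ _ (\int[P]_(w in [set w | (n%:R < K t w)%R]) (q n w)%:E)%E).
  apply: ge0_subset_integral => //.
  - by apply: measurable_funTS; exact: measurable_int (iq n).
  - move=> w _; rewrite lee_fin qE addr_ge0// mulr_ge0// ?addr_ge0// ?sqr_ge0// ltW//.
have NE w : N n%:R w = (N n%:R w - N 0 w)%N by rewrite (pf0 GN) subn0.
have n00 : 0 < n%:R - 0 :> R by rewrite subr0.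
have mY j : measurable [set w | N n%:R w = j] by apply: (pf_measurable_eq GN); exact: ltW.
pose A := [set w | n%:R < K t w].
have BY j : P (A `&` [set w | N n%:R w = j]) =
    (P A * (poisson_pmf (n%:R - 0) j)%:E)%E.
  rewrite -(pf_increment GN j (lexx _) n0 (GK _)); congr (P (_ `&` _)).
  by apply/seteqP; split => w /=; rewrite -NE.
have iqK : P.-integrable A (EFin \o q n).
  exact: (integrable_poisson_quadratic n00 (mK _) mY BY).
have -> : (\int[P]_(w in A) (q n w)%:E = (k * (n%:R * fine (P A)))%:E)%E.
  rewrite -[LHS]fineK; last by apply: integrable_fin_num => //; exact: mK.
  rewrite [X in (X%:E = _)%E](Rintegral_poisson_quadratic n00 (mK _) mY BY).
  by congr EFin; rewrite subr0 /k; ring.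
(* What remains is Markov's inequality kept on the event: [n * P A] is at most the integral of [K t]
   over [A]. *)
rewrite EFinM lee_wpmul2l ?lee_fin//.
rewrite EFinM fineK ?fin_num_measure//; last exact: mK.
rewrite -integral_cst; last exact: mK.
apply: ge0_le_integral => //.
- exact: mK.
- by move=> w _; rewrite lee_fin ltW.
- exact: measurable_funTS (measurable_int _ iK).
- by move=> w /ltW.
Unshelve. all: by end_near. Qed.

Let measurable_clk_le t c : 0 <= t -> measurable [set w | C t w <= c].
Proof.
move=> t0; rewrite -[X in measurable X]setTI -preimage_itvNyc.
by apply: clk_measurable.
Qed.

(** Over [{C s <= n}] the values at times [s] and [t], both stopped at level [n], have the same
    integral as the value at level [n]. For time [t] the region splits into [{C t <= n}], where the
    cap is invisible, and [E n], whose contribution vanishes by [remainder]. *)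
Lemma time_changed_mart a b s t B : 0 <= s -> s <= t -> F s B ->
  (\int[P]_(w in B) (time_changed a b t w)%:E =
   \int[P]_(w in B) (time_changed a b s w)%:E)%E.
Proof.
move=> s0 st FB; have t0 := le_trans s0 st.
have mB := F_measurable s0 FB.
have iZ r : 0 <= r -> P.-integrable B (EFin \o time_changed a b r).
  by move=> r0; apply: integrableS (time_changed_integrable a b r0).
have near_le r w : \forall n \near \oo, [set w | C r w <= n%:R] w.
  near=> n => /=; rewrite (le_trans (ler_norm _))//.
  by near: n; exact: nbhs_infty_ger.
pose E n := (B `&` [set w | C s w <= n%:R]) `&` [set w | n%:R < C t w].
have mgt r : measurable [set w | r < C t w].
  rewrite (_ : [set _ | _] = ~` [set w | C t w <= r]).
    by apply: measurableC; exact: measurable_clk_le.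
  by apply/seteqP; split => w /=; rewrite ltNge => /negP.
have mE n : measurable (E n).
  by apply: measurableI => //; apply: measurableI => //; exact: measurable_clk_le.
have EK n : E n `<=` [set w | n%:R < K t w].
  by move=> w [_ /=] /lt_le_trans; apply; exact: (clk_le CK).
have split_integral n :
  (\int[P]_(w in B `&` [set w | (C s w <= n%:R)%R]) (time_changed a b s w)%:E =
   \int[P]_(w in B `&` [set w | (C t w <= n%:R)%R]) (time_changed a b t w)%:E +
   \int[P]_(w in E n) (charlier a b n%:R (N n%:R w)%:R)%:E)%E.
  have n0 : 0 <= n%:R :> R by [].
  have [_ eqs] := OS a b s0 (lexx _) n0 FB.
  have [it eqt] := OS a b s0 st n0 FB.
  transitivity (\int[P]_(w in B `&` [set w | (C s w <= n%:R)%R])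
    (charlier a b n%:R (N n%:R w)%:R)%:E)%E.
    rewrite -eqs; apply: eq_integral => w; rewrite inE => -[_ /= Csn].
    by rewrite min_r.
  rewrite -eqt.
  have BE : B `&` [set w | C s w <= n%:R] = (B `&` [set w | C t w <= n%:R]) `|` E n.
    apply/seteqP; split => w.
      move=> [Bw Csn]; have [Ctn|nCt] := leP (C t w) n%:R; first by left.
      by right.
    move=> [[Bw /= Ctn]|[]//]; split => //=.
    exact: le_trans (clk_nondecreasing CK w s0 st) Ctn.
  rewrite BE integral_setU.
  - congr (_ + _)%E; apply: eq_integral => w; rewrite inE.
    + by move=> [_ /= Ctn]; rewrite min_r.
    + by move=> [_ /= nCt]; rewrite min_l// ltW.
  - by apply: measurableI => //; exact: measurable_clk_le.
  - exact: mE.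
  - by rewrite -BE; exact: measurable_int it.
  - rewrite disj_set2E; apply/eqP/seteqP; split => // w [[_ /= Ctn] [_ /=]].
    by rewrite ltNge Ctn.
have cvs := cvg_integral_eventually mB (fun n => measurable_clk_le n%:R s0)
  (iZ s s0) (near_le s).
have cvt := cvg_integral_eventually mB (fun n => measurable_clk_le n%:R t0)
  (iZ t t0) (near_le t).
have := cvgeD _ cvt (remainder a b t0 mE EK); rewrite adde0.
rewrite fin_num_adde_defl// => /(_ _ isT); rewrite -(funext split_integral) => h.
by apply: cvg_unique h cvs.
Unshelve. all: by end_near. Qed.

Let count_right w t : 0 <= t -> \forall s \near t^'+, D s w = D t w.
Proof.
move=> t0.
have /at_rightE[e e0 Ne] := pf_right_continuous GN w (clk_ge0 w t0).
near=> s; have ts : t < s by near: s; exact: nbhs_right_gt.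
have := clk_nondecreasing CK w t0 (ltW ts); rewrite /D le_eqVlt => /predU1P[<-//|Cts].
apply: Ne => //; near: s; apply: (cvgr_lt (C t w)); first exact: (clk_right CK).
by rewrite ltrDl.
Unshelve. all: by end_near. Qed.

Lemma count_nondecreasing w s t : 0 <= s -> s <= t -> (D s w <= D t w)%N.
Proof.
move=> s0 st; rewrite (pf_nondecreasing GN)//; first exact: clk_ge0.
exact: (clk_nondecreasing CK).
Qed.

Let cvg_charlier_clk a b x w (H : set_system R) : Filter H -> forall y,
  C s w @[s --> H] --> y ->
  charlier a b (C s w) x @[s --> H] --> charlier a b y x.
Proof.
move=> FH y Cy; have h : x - C s w @[s --> H] --> x - y.
  by apply: cvgB => //; exact: cvg_cst.
rewrite /charlier; apply: cvgD; apply: cvgM; [exact: cvg_cst|exact: h|exact: cvg_cst|].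
apply: cvgB => //; rewrite expr2; under eq_fun do rewrite expr2.
exact: cvgM.
Qed.

Lemma time_changed_left_limit a b w t k : 0 < t ->
  (\forall s \near t^'-, D s w = k) ->
  time_changed a b s w @[s --> t^'-] --> charlier a b (C t w) k%:R.
Proof.
move=> t0 Dk; have /(_ _) := @cvg_charlier_clk a b k%:R w _ _ _ (clk_left CK t0).
apply: cvg_trans; apply: near_eq_cvg; near=> s.
by rewrite /time_changed -/(D s w); congr charlier; congr (_%:R); apply/esym; near: s.
Unshelve. all: by end_near. Qed.

Lemma cadlag_time_changed a b w : cadlag (time_changed a b ^~ w).
Proof.
split=> t t0.
  have /(_ _) := @cvg_charlier_clk a b (D t w)%:R w _ _ _ (clk_right CK t0).
  apply: cvg_trans; apply: near_eq_cvg; near=> s.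
  by rewrite /time_changed -/(D s w); congr charlier; congr (_%:R); apply/esym;
    near: s; exact: count_right.
have [k kP] := nondecreasing_nat_left_const t0 (@count_nondecreasing w).
by apply/cvg_ex; eexists; exact: time_changed_left_limit kP.
Unshelve. all: by end_near. Qed.

Lemma adapted_time_changed a b : adapted F (time_changed a b).
Proof.
move=> t t0 U mU; rewrite -(sigma_algebra_measurableE (sF t0)) -[X in measurable X]setTI.
have mC : measurable_fun [set: g_sigma_algebraType (F t)] (C t).
  move=> _ V mV; rewrite setTI (sigma_algebra_measurableE (sF t0)).
  exact: (clk_adapted CK).
have mD : measurable_fun [set: g_sigma_algebraType (F t)] (fun w => (D t w)%:R : R).
  apply: (measurableT_comp (f := fun k => k%:R : R)) => //.
  apply: measurable_nat_fun => k; rewrite (sigma_algebra_measurableE (sF t0)).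
  exact: (clk_count_adapted CK).
rewrite /time_changed /charlier.
suff : measurable_fun [set: g_sigma_algebraType (F t)]
    (fun w => a * ((D t w)%:R - C t w) + b * (((D t w)%:R - C t w) ^+ 2 - C t w)).
  by apply.
apply: measurable_funD.
  by apply: measurable_funM => //; exact: measurable_funB.
apply: measurable_funM => //; apply: measurable_funB => //.
by apply: measurable_funX; exact: measurable_funB.
Qed.

Lemma martingale_time_changed a b : martingale P F (time_changed a b).
Proof.
split.
- exact: adapted_time_changed.
- exact: time_changed_integrable.
- move=> s t s0 st; split.
  + exact: adapted_time_changed.
  + exact: time_changed_integrable.
  + by move=> B FB; rewrite -(time_changed_mart a b s0 st FB).
- exact: cadlag_time_changed.
Qed.

End time_change.

(** * Independence of Poisson increments from the past *)

Section independence.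
Context {d : measure_display} {T : measurableType d} {R : realType}.
Variable P : probability T R.
Implicit Types (B C : set T) (E : set (set T)).

Lemma sub_g_sigma_algebra E B : E B -> <<s E >> B.
Proof. by move=> EB; exact: sub_sigma_algebra. Qed.

Lemma g_sigma_algebra_measurable E : E `<=` measurable -> <<s E >> `<=` measurable.
Proof. by move=> Em; apply: smallest_sub => //; exact: sigma_algebra_measurable. Qed.

Lemma g_sigma_algebra_setI E B C : <<s E >> B -> <<s E >> C -> <<s E >> (B `&` C).
Proof. by apply: sigma_algebra_setI; exact: smallest_sigma_algebra. Qed.

Lemma sub_g_sigma_algebraS E E' : E `<=` <<s E' >> -> <<s E >> `<=` <<s E' >>.
Proof. by move=> h; apply: smallest_sub => //; exact: smallest_sigma_algebra. Qed.

(** For fixed [C] the events obeying the product formula form a lambda-system, so Dynkin's theorem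
    carries the formula from the pi-system [E] to what it generates. *)
Lemma g_sigma_algebra_independent E C : setI_closed E -> E `<=` measurable ->
  measurable C -> (forall B, E B -> P (B `&` C) = (P B * P C)%E) ->
  forall B, <<s E >> B -> P (B `&` C) = (P B * P C)%E.
Proof.
move=> EI Em mC EC B sB.
suff : <<s E >> `<=` [set B | measurable B /\ P (B `&` C) = (P B * P C)%E].
  by move=> /(_ B sB) [].
apply: lambda_system_subset => //; last by move=> A EA; split; [exact: Em|exact: EC].
apply/dynkin_lambda_system; split.
- by split => //; rewrite setTI probability_setT mul1e.
- move=> A [mA PA]; split; first exact: measurableC.
  rewrite setIC -setDE measureD//;
    last by rewrite (le_lt_trans (probability_le1 P mC))// ltry.
  transitivity (P C - P A * P C)%E; first by congr (_ - _)%E; rewrite setIC.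
  rewrite probability_setC// -[P A]fineK ?fin_num_measure// -[P C]fineK ?fin_num_measure//.
  by rewrite -EFinM -!EFinB -EFinM; congr EFin; ring.
- move=> F tF mF; have mF1 n : measurable (F n) by have [] := mF n.
  split; first exact: bigcupT_measurable.
  rewrite setI_bigcupl measure_bigcup//; last 2 first.
    by move=> n _; exact: measurableI.
    apply: trivIset_setIr => //.
  rewrite measure_bigcup// -[P C]fineK ?fin_num_measure// muleC -nneseriesZl//.
  apply: eq_eseriesr => n _; transitivity (P (F n) * P C)%E; first exact: (mF n).2.
  by rewrite muleC fineK// fin_num_measure.
Qed.

Lemma setI_closed_meets E E' :
  setI_closed [set B | exists B1 B2, [/\ <<s E >> B1, <<s E' >> B2 & B = B1 `&` B2]].
Proof.
move=> _ _ [B1 [B2 [s1 s2 ->]]] [C1 [C2 [t1 t2 ->]]].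
exists (B1 `&` C1), (B2 `&` C2); rewrite setIACA; split => //;
  exact: g_sigma_algebra_setI.
Qed.

Lemma sub_meets_l E E' B : <<s E >> B ->
  exists B1 B2, [/\ <<s E >> B1, <<s E' >> B2 & B = B1 `&` B2].
Proof.
move=> EB; exists B, setT; rewrite setIT; split => //.
by apply: sigma_algebra_setT; exact: smallest_sigma_algebra.
Qed.

Lemma sub_meets_r E E' B : <<s E' >> B ->
  exists B1 B2, [/\ <<s E >> B1, <<s E' >> B2 & B = B1 `&` B2].
Proof.
move=> EB; exists setT, B; rewrite setTI; split => //.
by apply: sigma_algebra_setT; exact: smallest_sigma_algebra.
Qed.

Lemma independentC E E' : independent P E E' -> independent P E' E.
Proof. by move=> h B C EB EC; rewrite setIC muleC; exact: h. Qed.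

(** With [E1] the initial queue length and [E2], [E3] the two Poisson processes in either order,
    this allows one whole process in the past at level 0. On a meet the probability factors twice:
    [E1] splits from the rest, then [E2] from [E3]. *)
Lemma independent_setU E1 E2 E3 : E1 `<=` measurable -> E2 `<=` measurable ->
  E3 `<=` measurable ->
  independent P <<s E1 >> <<s E2 `|` E3 >> -> independent P <<s E2 >> <<s E3 >> ->
  independent P <<s E1 `|` E2 >> <<s E3 >>.
Proof.
move=> m1 m2 m3 i1 i2 B C sB sC.
have mC : measurable C by exact: g_sigma_algebra_measurable sC.
have s2 : <<s E2 >> `<=` <<s E2 `|` E3 >> by apply: sub_g_sigma_algebraS => A EA;
  apply: sub_g_sigma_algebra; left.
have s3 : <<s E3 >> `<=` <<s E2 `|` E3 >> by apply: sub_g_sigma_algebraS => A EA;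
  apply: sub_g_sigma_algebra; right.
apply: (g_sigma_algebra_independent (@setI_closed_meets E1 E2)) => //.
- move=> _ [B1 [B2 [? ? ->]]]; apply: measurableI.
    exact: (g_sigma_algebra_measurable m1).
  exact: (g_sigma_algebra_measurable m2).
- move=> _ [B1 [B2 [sB1 sB2 ->]]]; rewrite -setIA i1//; last first.
    by apply: g_sigma_algebra_setI; [exact: s2|exact: s3].
  by rewrite i2// muleA; congr (_ * _)%E; apply/esym/i1 => //; exact: s2.
- apply: sub_g_sigma_algebraS sB => A [EA|EA]; apply: sub_g_sigma_algebra.
    by apply: sub_meets_l; exact: sub_g_sigma_algebra.
  by apply: sub_meets_r; exact: sub_g_sigma_algebra.
Qed.

Lemma measurable_process_events d' (E' : measurableType d') (D : set R)
  (Y : R -> {RV P >-> E'}) :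
  process_events D (fun t => Y t) `<=` measurable.
Proof.
move=> _ [t [U [_ mU ->]]]; rewrite -[X in measurable X]setTI.
exact: measurable_funP.
Qed.

Lemma measurable_increment (X Y : {RV P >-> nat}) (D : set nat) :
  measurable [set w | D (Y w - X w)%N].
Proof.
rewrite (_ : [set _ | _] = \bigcup_(p in [set p : nat * nat | D (p.1 - p.2)%N])
    ((Y @^-1` [set p.1]) `&` (X @^-1` [set p.2]))); last first.
  apply/seteqP; split => [w /= Dw|w [p /= pD [/= -> ->]]//].
  by exists (Y w, X w).
rewrite bigcup_mkcond; apply: countable_bigcupT_measurable => // p.
by case: ifPn => // _; apply: measurableI; rewrite -[X in measurable X]setTI;
  exact: measurable_funP.
Qed.

End independence.

Section poisson_past.
Context {d : measure_display} {T : measurableType d} {R : realType}.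
Variable P : probability T R.
Variable N : R -> {RV P >-> nat}.
Hypothesis NP : poisson_process 1 N.
Implicit Types (u v : R) (B C : set T).

Definition cylinder (l : seq (R * nat)) : set T :=
  [set w | all (fun p => N p.1 w == p.2) l].

Lemma measurable_cylinder l : measurable (cylinder l).
Proof.
elim: l => [|[t k] l IH]; first by rewrite (_ : cylinder _ = setT)//; apply/seteqP.
rewrite (_ : cylinder _ = (N t @^-1` [set k]) `&` cylinder l).
  apply: measurableI => //; rewrite -[X in measurable X]setTI.
  exact: measurable_funP.
apply/seteqP; split => w; rewrite /cylinder /=; first by move=> /andP[/eqP].
by move=> [/eqP -> ->].
Qed.

(* A cylinder event over sorted times is an intersection of increment events,
   or empty when the prescribed values are not nondecreasing. *)
Lemma sorted_cylinder_independent l u v k : 0 <= u -> u < v ->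
  sorted <=%R (map fst l) -> all (fun p => 0 <= p.1 <= u) l ->
  P (cylinder l `&` [set w | (N v w - N u w)%N = k]) =
  (P (cylinder l) * P [set w | (N v w - N u w)%N = k])%E.
Proof.
(* The times are 0, those of [l], [u], and then always [v], the default of [nth], so [t] is
   nondecreasing on all indices. Increment [m] leads from the last time of [l] to [u] and is left
   free; increment [m.+1] leads from [u] to [v]. *)
move=> u0 uv sl lu; pose tl := 0 :: rcons (map fst l) u.
pose kl := 0%N :: map snd l; pose m := size l.
pose t i := nth v tl i.
have stl : sorted <=%R tl.
  rewrite /tl /= rcons_path; apply/andP; split.
    case: l sl lu {tl kl m t} => //= p l sl /andP[/andP[p0 _] _].
    by rewrite p0.
  have := mem_last 0 (map fst l); rewrite inE => /predU1P[->//|/mapP[p pl ->]].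
  by move/allP : lu => /(_ p pl) /andP[].
have tlv : all (fun r => r <= v) tl.
  rewrite /tl /= all_rcons (le_trans u0 (ltW uv)) (ltW uv)/=.
  by apply/allP => _ /mapP[p pl ->]; move/allP : lu => /(_ p pl) /andP[_ /le_trans];
    apply; exact: ltW.
have tnd i : t i <= t i.+1.
  have [h|h] := ltnP i.+1 (size tl); first exact: (sortedP v stl).
  rewrite [leRHS]nth_default//; have [h'|h'] := ltnP i (size tl).
    by move/all_nthP : tlv; apply.
  by rewrite /t nth_default.
have szt : size tl = m.+2 by rewrite /= size_rcons size_map.
have tm1 : t m.+1 = u.
  by rewrite /t /tl /= nth_rcons size_map ltnn eqxx.
have tm2 : t m.+2 = v by rewrite /t nth_default// szt.
have tE i : (i < m)%N -> t i.+1 = (nth (0, 0%N) l i).1.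
  move=> im; rewrite /t /tl /= nth_rcons size_map im.
  by rewrite (nth_map (0, 0%N)).
have kE i : (i < m)%N -> nth 0%N kl i.+1 = (nth (0, 0%N) l i).2.
  by move=> im; rewrite /kl /= (nth_map (0, 0%N)).
pose U i : set nat := if (i < m)%N then [set (nth 0%N kl i.+1 - nth 0%N kl i)%N]
  else if i == m then setT else [set k].
pose inc i w := (N (t i.+1) w - N (t i) w)%N.
have cylP w : cylinder l w <-> forall i, (i <= m)%N -> N (t i) w = nth 0%N kl i.
  split=> [lw [_|i im]|h].
  - by rewrite /t /= (poisson_process0 NP).
  - rewrite tE// kE//; move/all_nthP : lw => /(_ (0, 0%N) i im) /eqP.
    by [].
  - apply/(all_nthP (0, 0%N)) => i im; rewrite -tE// -kE//; apply/eqP.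
    exact: h.
have t0 i : 0 <= t i.
  elim: i => [|i IH]; first by rewrite /t.
  exact: le_trans IH (tnd i).
have Ninc w i : (N (t i) w <= N (t i.+1) w)%N.
  exact: (poisson_process_nondecreasing NP).
have [skl|nskl] := boolP (sorted leq kl); last first.
  suff -> : cylinder l = set0 by rewrite set0I measure0 mul0e.
  apply/seteqP; split => // w /cylP h; move/negP : nskl; apply.
  apply/(sortedP 0%N) => i; rewrite /= size_map ltnS => im.
  by have := Ninc w i; rewrite !h// ltnW.
have cylE : cylinder l = \bigcap_(i in `I_m.+1) [set w | U i (inc i w)].
  apply/seteqP; split => w.
    move=> /cylP h i /= im1; rewrite /U; have [im|mi] := ltnP i m.
      by rewrite /= /inc !h// ltnW.
    by rewrite ifT// eqn_leq mi andbT -ltnS.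
  move=> h; apply/cylP; elim=> [_|i IH im].
    by rewrite /t /= (poisson_process0 NP).
  have /= := h i; rewrite /U im => /(_ (leqW im)) /=.
  rewrite /inc IH; last exact: ltnW.
  move=> e; rewrite -[LHS](subnK (Ninc w i)) IH ?e; last exact: ltnW.
  rewrite subnK//; apply: (sortedP 0%N skl).
  by rewrite /= size_map ltnS.
have Um1 : U m.+1 = [set k] by rewrite /U ltnNge leqnSn /= gtn_eqF.
have cylIE : cylinder l `&` [set w | (N v w - N u w)%N = k] =
    \bigcap_(i in `I_m.+2) [set w | U i (inc i w)].
  rewrite cylE; apply/seteqP; split => w.
    move=> [h wk] i /=; rewrite ltnS leq_eqVlt => /predU1P[->|]; last exact: h.
    by rewrite Um1 /inc tm1 tm2.
  move=> h; split; first by move=> i /= im; apply: h; exact: leqW.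
  by have := h m.+1; rewrite /= ltnSn => /(_ isT); rewrite Um1 /inc tm1 tm2.
rewrite cylIE (poisson_process_independent_increments NP)// big_ord_recr/=.
rewrite -(poisson_process_independent_increments NP)//.
rewrite -[X in P X]/(\bigcap_(i in `I_m.+1) [set w | U i (inc i w)]) -cylE.
by rewrite Um1 tm1 tm2.
Qed.

Lemma cylinder_independent l u v k : 0 <= u -> u < v ->
  all (fun p => 0 <= p.1 <= u) l ->
  P (cylinder l `&` [set w | (N v w - N u w)%N = k]) =
  (P (cylinder l) * P [set w | (N v w - N u w)%N = k])%E.
Proof.
move=> u0 uv lu; pose l' := sort (fun p q : R * nat => p.1 <= q.1) l.
have -> : cylinder l = cylinder l'.
  by apply/seteqP; split => w; rewrite /cylinder /= all_sort.
apply: sorted_cylinder_independent => //; last by rewrite all_sort.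
by rewrite sorted_map sort_sorted// => p q; exact: le_total.
Qed.

(** Concatenating lists of constraints intersects cylinders, so the cylinders with times up to [u]
    form a pi-system generating the past of [N]. *)
Lemma poisson_increment_independent u v k B : 0 <= u -> u < v ->
  <<s process_events `[0, u] (fun t => N t) >> B ->
  P (B `&` [set w | (N v w - N u w)%N = k]) =
  (P B * P [set w | (N v w - N u w)%N = k])%E.
Proof.
move=> u0 uv sB.
pose E := [set B | exists2 l, all (fun p => 0 <= p.1 <= u) l & B = cylinder l].
apply: (g_sigma_algebra_independent (E := E)).
- move=> _ _ [l lu ->] [l' l'u ->]; exists (l ++ l'); first by rewrite all_cat lu.
  by apply/seteqP; split => w; rewrite /cylinder /= all_cat => /andP.
- by move=> _ [l _ ->]; exact: measurable_cylinder.
- exact: (measurable_increment (N u) (N v) [set k]).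
- by move=> _ [l lu ->]; exact: cylinder_independent.
- apply: sub_g_sigma_algebraS sB => _ [t [U [/= tu _ ->]]].
  rewrite (_ : _ @^-1` _ = \bigcup_(j in U) cylinder [:: (t, j)]).
    apply: sigma_algebra_bigcup_nat; first exact: smallest_sigma_algebra.
    move=> j _; apply: sub_g_sigma_algebra; exists [:: (t, j)] => //=.
    by rewrite andbT; move: tu; rewrite in_itv.
  apply/seteqP; split => w /=.
    by move=> Uw; exists (N t w) => //; rewrite /cylinder /= eqxx.
  by move=> [j Uj]; rewrite /cylinder /= andbT => /eqP ->.
Qed.

(* [E] carries everything else that is observed from time 0 on. *)
Definition past (E : set (set T)) u : set (set T) :=
  <<s E `|` process_events `[0, u] (fun t => N t) `|` null_sets P >>.

(** The pi-system consists of the meets of [E] with the past of [N], together with the null sets: a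
    null set meets any event in a null set, and the product formula is trivial there. On a meet, [E]
    is split off, the increment is separated from the past of [N], and [E] is put back. *)
Lemma past_independent E u v k B : E `<=` measurable ->
  independent P <<s E >> <<s process_events `[0, +oo[ (fun t => N t) >> ->
  0 <= u -> u < v -> past E u B ->
  P (B `&` [set w | (N v w - N u w)%N = k]) =
  (P B * (poisson_pmf (v - u) k)%:E)%E.
Proof.
move=> mE iE u0 uv sB; set I := [set w | _].
rewrite -[v - u]mul1r -(poisson_process_increment NP k u0 uv) -/I.
pose Eu := process_events `[0, u] (fun t => N t).
pose Eo := process_events `[0, +oo[ (fun t => N t).
have sNu t U : 0 <= t -> <<s Eo >> (N t @^-1` U).
  move=> t0; apply: sub_g_sigma_algebra; exists t, U; split => //=.
  by rewrite in_itv/= t0.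
have Euo : <<s Eu >> `<=` <<s Eo >>.
  apply: sub_g_sigma_algebraS => _ [t [U [/= tu _ ->]]].
  by apply: sNu; move: tu; rewrite in_itv => /andP[].
have mEo : Eo `<=` measurable by exact: measurable_process_events.
have mEu : Eu `<=` measurable by exact: measurable_process_events.
have v0 : 0 <= v by rewrite (le_trans u0)// ltW.
have sI : <<s Eo >> I.
  rewrite (_ : I = \bigcup_i ((N v @^-1` [set i]) `&`
      \bigcup_(j in [set j | (i - j)%N = k]) (N u @^-1` [set j]))); last first.
    apply/seteqP; split => [w /= Nw|w [i _ [/= Nv [j /= jk Nu]]]].
      by exists (N v w) => //; split => //; exists (N u w).
    by rewrite /I /= Nv Nu.
  apply: sigma_algebra_bigcup_nat; first exact: smallest_sigma_algebra.
  move=> i _; apply: g_sigma_algebra_setI; first exact: sNu.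
  apply: sigma_algebra_bigcup_nat; first exact: smallest_sigma_algebra.
  by move=> j _; exact: sNu.
have mI : measurable I by exact: g_sigma_algebra_measurable sI.
have mm B1 B2 : <<s E >> B1 -> <<s Eu >> B2 -> measurable (B1 `&` B2).
  move=> s1 s2; apply: measurableI; first exact: (g_sigma_algebra_measurable mE).
  exact: (g_sigma_algebra_measurable mEu).
pose M := [set B | exists B1 B2, [/\ <<s E >> B1, <<s Eu >> B2 & B = B1 `&` B2]].
have null_setI A B' : null_sets P A -> measurable B' -> null_sets P (A `&` B').
  move=> [mA PA] mB'; split; first exact: measurableI.
  have h : (P (A `&` B') <= P A)%E by exact: measureIl.
  rewrite PA in h.
  by apply/eqP; rewrite eq_le h measure_ge0.
apply: (g_sigma_algebra_independent (E := M `|` null_sets P)) => //.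
- move=> A B' [MA|nA] [MB'|nB'].
  + by left; exact: setI_closed_meets.
  + by right; rewrite setIC; apply: null_setI => //; move: MA => [? [? [? ? ->]]];
      exact: mm.
  + by right; apply: null_setI => //; move: MB' => [? [? [? ? ->]]]; exact: mm.
  + by right; apply: null_setI => //; case: nB'.
- by move=> A [[? [? [? ? ->]]]|[]//]; exact: mm.
- move=> A [[B1 [B2 [s1 s2 ->]]]|nA]; last first.
    by rewrite (null_setI _ _ nA mI).2 nA.2 mul0e.
  rewrite -setIA iE//; last by apply: g_sigma_algebra_setI => //; exact: Euo.
  rewrite poisson_increment_independent// iE ?muleA//; exact: Euo.
- apply: sub_g_sigma_algebraS sB => A [[EA|EA]|nA]; apply: sub_g_sigma_algebra.
  + by left; apply: sub_meets_l; exact: sub_g_sigma_algebra.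
  + by left; apply: sub_meets_r; exact: sub_g_sigma_algebra.
  + by right.
Qed.

Lemma filtration_past E : E `<=` measurable -> filtration (past E).
Proof.
move=> mE; split.
- by move=> u u0; exact: smallest_sigma_algebra.
- move=> u u0; apply: g_sigma_algebra_measurable => A [[/mE//|EA]|[]//].
  exact: measurable_process_events EA.
- move=> u v u0 uv; apply: sub_g_sigma_algebraS => A [[EA|[t [U [/= tu mU ->]]]]|nA];
    apply: sub_g_sigma_algebra.
  + by left; left.
  + left; right; exists t, U; split => //=; move: tu; rewrite !in_itv/=.
    by move=> /andP[-> /le_trans]; apply.
  + by right.
Qed.

Lemma poisson_in_past E : E `<=` measurable ->
  independent P <<s E >> <<s process_events `[0, +oo[ (fun t => N t) >> ->
  poisson_in_filtration P (past E) (fun t => N t).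
Proof.
move=> mE iE; split.
- exact: filtration_past.
- move=> u k u0; apply: sub_g_sigma_algebra; left; right.
  by exists u, [set k]; split => //=; rewrite in_itv/= u0 lexx.
- by move=> u v B k u0 uv; exact: past_independent.
- exact: (poisson_process0 NP).
- by move=> w u v; exact: (poisson_process_nondecreasing NP).
- by move=> w u; exact: (poisson_process_right_continuous NP).
Qed.

End poisson_past.

(** * Integrals of paths *)

Section running_integral.
Context {R : realType}.
Notation mu := (@lebesgue_measure R).
Implicit Types (f g : R -> R) (a b t : R).

Definition running_integral f t : R := \int[mu]_(s in `[0, t]) f s.

Definition nondecreasing_path f := forall r s, 0 <= r -> r <= s -> f r <= f s.

Definition integrable_path f :=
  forall t, mu.-integrable `[0, t] (EFin \o f).

Lemma lebesgue_itv_lty (x y : bool) a b :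
  (mu [set` Interval (BSide x a) (BSide y b)] < +oo)%E.
Proof.
rewrite -[X in (X < _)%E]/(lebesgue_measure _) lebesgue_measure_itv.
by case: ifP => // _; rewrite -EFinB ltry.
Qed.

Lemma running_integral0 f : running_integral f 0 = 0.
Proof. by rewrite /running_integral set_itv1 Rintegral_set1. Qed.

Lemma measurable_bounded_path f t k :
  measurable_fun `[0, t] f -> (forall s, 0 <= s -> s <= t -> `|f s| <= k) ->
  mu.-integrable `[0, t] (EFin \o f).
Proof.
move=> mf fk; apply: measurable_bounded_integrable => //.
  exact: lebesgue_itv_lty.
exists k; split; first by rewrite num_real.
move=> x kx s /=; rewrite in_itv/= => /andP[s0 st].
by rewrite (le_trans (fk s s0 st))// ltW.
Qed.

Lemma nondecreasing_path_integrable f :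
  nondecreasing_path f -> integrable_path f.
Proof.
move=> fnd t; apply: (@measurable_bounded_path _ _ (`|f 0| + `|f t|)).
  (* The path is known to be nondecreasing only from 0 on; composing with [max 0] makes it monotone
     on the whole line and leaves it unchanged on [[0, t]]. *)
  apply: (eq_measurable_fun (fun s : R => f (Num.max 0 s))).
    by move=> s; rewrite inE/= in_itv/= => /andP[s0 _]; rewrite max_r.
  apply: nondecreasing_measurable => // r s rs; apply: fnd.
    by rewrite le_max lexx.
  by rewrite ge_max !le_max lexx rs/= orbT.
move=> s s0 st; have := fnd _ _ (lexx 0) s0; have := fnd _ _ s0 st.
have := ler_norm (f t); have := ler_norm (- f 0); have := normr_ge0 (f 0);
  have := normr_ge0 (f t).
by rewrite normrN ler_norml => *; apply/andP; split; lra.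
Qed.

Lemma running_integralB f a b : integrable_path f -> 0 <= a -> a <= b ->
  running_integral f b - running_integral f a = \int[mu]_(s in `]a, b]) f s.
Proof. by move=> fi a0 ab; rewrite /running_integral Rintegral_itvB// bnd_simp. Qed.

Lemma integrable_itvoc f a b : integrable_path f -> 0 <= a ->
  mu.-integrable `]a, b] (EFin \o f).
Proof.
move=> fi a0; apply: integrableS (fi b) => // s /=.
by rewrite !in_itv/= => /andP[/ltW/(le_trans a0) -> ->].
Qed.

Lemma Rintegral_itvoc_cst a b c : a <= b -> \int[mu]_(s in `]a, b]) c = c * (b - a).
Proof.
move=> ab; rewrite Rintegral_cst//.
rewrite -[X in fine X]/(lebesgue_measure _) lebesgue_measure_itv/= lte_fin.
case: ltP => [//|ba].
have -> : a = b by apply/eqP; rewrite eq_le ab.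
by rewrite subrr mulr0.
Qed.

Lemma integrable_itvoc_cst a b c : mu.-integrable `]a, b] (EFin \o (fun=> c : R)).
Proof.
apply: measurable_bounded_integrable => //.
  exact: lebesgue_itv_lty.
exists `|c|; split; first by rewrite num_real.
by move=> x kx s _ /=; rewrite ltW.
Qed.

Lemma running_integralB_le f a b c : integrable_path f -> 0 <= a -> a <= b ->
  (forall s, a < s -> s <= b -> f s <= c) ->
  running_integral f b - running_integral f a <= c * (b - a).
Proof.
move=> fi a0 ab fc; rewrite running_integralB// -Rintegral_itvoc_cst//.
apply: le_Rintegral => //; [exact: integrable_itvoc|exact: integrable_itvoc_cst|].
by move=> s /=; rewrite in_itv/= => /andP[? ?]; exact: fc.
Qed.

Lemma running_integralB_ge f a b c : integrable_path f -> 0 <= a -> a <= b ->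
  (forall s, a < s -> s <= b -> c <= f s) ->
  c * (b - a) <= running_integral f b - running_integral f a.
Proof.
move=> fi a0 ab fc; rewrite running_integralB// -Rintegral_itvoc_cst//.
apply: le_Rintegral => //; [exact: integrable_itvoc_cst|exact: integrable_itvoc|].
by move=> s /=; rewrite in_itv/= => /andP[? ?]; exact: fc.
Qed.

Lemma le_running_integral f g t : integrable_path f ->
  integrable_path g -> (forall s, 0 <= s -> s <= t -> f s <= g s) ->
  running_integral f t <= running_integral g t.
Proof.
move=> fi gi fg; apply: le_Rintegral => //.
by move=> s /=; rewrite in_itv/= => /andP[]; exact: fg.
Qed.

Lemma eq_running_integral f g t : (forall s, 0 <= s -> s <= t -> f s = g s) ->
  running_integral f t = running_integral g t.
Proof.
move=> fg; apply: eq_Rintegral => s; rewrite inE/= in_itv/= => /andP[].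
exact: fg.
Qed.

Lemma integrable_path_cst c : integrable_path (fun=> c).
Proof. by move=> t; apply: nondecreasing_path_integrable. Qed.

Lemma integrable_pathD f g : integrable_path f ->
  integrable_path g -> integrable_path (fun s => f s + g s).
Proof. by move=> fi gi t; exact: (integrableD _ (fi t) (gi t)). Qed.

Lemma integrable_pathB f g : integrable_path f ->
  integrable_path g -> integrable_path (fun s => f s - g s).
Proof. by move=> fi gi t; exact: (integrableB _ (fi t) (gi t)). Qed.

Lemma running_integral_cst c t : 0 <= t -> running_integral (fun=> c) t = c * t.
Proof.
move=> t0; rewrite -[LHS]subr0 -(running_integral0 (fun=> c)).
rewrite running_integralB ?Rintegral_itvoc_cst ?subr0//; exact: integrable_path_cst.
Qed.

Lemma running_integralD f g t : integrable_path f -> integrable_path g ->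
  running_integral (fun s => f s + g s) t = running_integral f t + running_integral g t.
Proof. by move=> fi gi; rewrite /running_integral RintegralD. Qed.

Lemma running_integral_sub f g t : integrable_path f -> integrable_path g ->
  running_integral (fun s => f s - g s) t = running_integral f t - running_integral g t.
Proof. by move=> fi gi; rewrite /running_integral RintegralB. Qed.

Lemma running_integral_right f t : nondecreasing_path f -> 0 <= t ->
  running_integral f s @[s --> t^'+] --> running_integral f t.
Proof.
move=> fnd t0; have fi := nondecreasing_path_integrable fnd.
have lim c : running_integral f t + c * (s - t) @[s --> t^'+] --> running_integral f t.
  rewrite -[X in _ --> X]addr0; apply: cvgD; first exact: cvg_cst.
  rewrite -(mulr0 c); apply: cvgM; first exact: cvg_cst.
  by rewrite -(subrr t); apply: cvgB; [exact: cvg_at_right_filter|exact: cvg_cst].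
apply: (squeeze_cvgr _ (lim (f t)) (lim (f (t + 1)))).
near=> s; have ts : t < s by near: s; exact: nbhs_right_gt.
have st1 : s <= t + 1 by apply: ltW; near: s; apply: nbhs_right_lt; rewrite ltrDl.
apply/andP; split.
  rewrite -lerBrDl running_integralB_ge ?(ltW ts)// => r tr rs.
  by apply: fnd => //; exact: ltW.
rewrite -lerBlDl running_integralB_le ?(ltW ts)// => r tr rs; apply: fnd.
  by rewrite (le_trans t0)// ltW.
exact: le_trans st1.
Unshelve. all: by end_near. Qed.

Lemma running_integral_left f t : nondecreasing_path f -> 0 < t ->
  running_integral f s @[s --> t^'-] --> running_integral f t.
Proof.
move=> fnd t0; have fi := nondecreasing_path_integrable fnd.
have lim c : running_integral f t - c * (t - s) @[s --> t^'-] --> running_integral f t.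
  rewrite -[X in _ --> X]subr0; apply: cvgB; first exact: cvg_cst.
  rewrite -(mulr0 c); apply: cvgM; first exact: cvg_cst.
  by rewrite -(subrr t); apply: cvgB; [exact: cvg_cst|exact: cvg_at_left_filter].
apply: (squeeze_cvgr _ (lim (f t)) (lim (f 0))).
near=> s; have st : s < t by near: s; exact: nbhs_left_lt.
have s0 : 0 <= s by apply: ltW; near: s; exact: nbhs_left_gt.
apply/andP; split.
  rewrite lerBlDr -lerBlDl running_integralB_le ?(ltW st)//.
  by move=> r sr rt; apply: fnd => //; rewrite (le_trans s0)// ltW.
rewrite lerBrDr -lerBrDl running_integralB_ge ?(ltW st)// => r sr rt.
by apply: fnd => //; rewrite (le_trans s0)// ltW.
Unshelve. all: by end_near. Qed.

(** Riemann sums use the path at finitely many times in [[0, t]], so a running integral is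
    measurable for any sigma-algebra that knows these values. For a nondecreasing path the upper sum
    exceeds the integral by at most the mesh times the total increase. *)
Lemma cvg_riemann_sum f t : nondecreasing_path f -> 0 <= t ->
  \sum_(i < m.+1) f (i.+1%:R * (t / m.+1%:R)) * (t / m.+1%:R) @[m --> \oo] -->
  running_integral f t.
Proof.
move=> fnd t0; have fi := nondecreasing_path_integrable fnd.
have bounds h j : 0 <= h -> running_integral f (j%:R * h) <=
    \sum_(i < j) f (i.+1%:R * h) * h <=
    running_integral f (j%:R * h) + h * (f (j%:R * h) - f 0).
  move=> h0; elim: j => [|j /andP[IH1 IH2]].
    by rewrite big_ord0 mul0r running_integral0 subrr mulr0 addr0 lexx.
  have jh0 : 0 <= j%:R * h by rewrite mulr_ge0.
  have jh : j%:R * h <= j.+1%:R * h by rewrite ler_wpM2r// ler_nat.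
  have hE : j.+1%:R * h - j%:R * h = h by rewrite -mulrBl -natrB// subSnn mul1r.
  have := running_integralB_le (c := f (j.+1%:R * h)) fi jh0 jh.
  have := running_integralB_ge (c := f (j%:R * h)) fi jh0 jh.
  rewrite hE => h1 h2; rewrite big_ord_recr/=.
  have {}h1 := h1 (fun r jr _ => fnd _ _ jh0 (ltW jr)).
  have {}h2 := h2 (fun r jr rj => fnd _ _ (le_trans jh0 (ltW jr)) rj).
  by apply/andP; split; lra.
have mE (m : nat) : m.+1%:R * (t / m.+1%:R) = t by rewrite mulrCA divff ?mulr1// pnatr_eq0.
apply: (@squeeze_cvgr _ _ _ _ (cst (running_integral f t))
  (fun m => running_integral f t + (t * (f t - f 0)) * m.+1%:R^-1)).
- near=> m; have := bounds (t / m.+1%:R) m.+1; rewrite mE /=.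
  rewrite divr_ge0// => /(_ isT) /andP[-> /=] /le_trans; apply.
  by rewrite mulrAC.
- exact: cvg_cst.
- rewrite -[X in _ --> X]addr0; apply: cvgD; first exact: cvg_cst.
  rewrite -[X in _ --> X](mulr0 (t * (f t - f 0))); apply: cvgM; first exact: cvg_cst.
  exact: cvg_harmonic.
Unshelve. all: by end_near. Qed.

Lemma measurable_running_integral d (T : measurableType d) (Y : R -> T -> R) t :
  0 <= t -> (forall w, nondecreasing_path (Y ^~ w)) ->
  (forall s, 0 <= s -> s <= t -> measurable_fun [set: T] (Y s)) ->
  measurable_fun [set: T] (fun w => running_integral (Y ^~ w) t).
Proof.
move=> t0 Ynd mY.
apply: (measurable_fun_cvg (h := fun m w =>
  \sum_(i < m.+1) Y (i.+1%:R * (t / m.+1%:R)) w * (t / m.+1%:R))).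
  move=> m; apply: measurable_sum => i; apply: measurable_funM => //.
  apply: mY; first by rewrite mulr_ge0// divr_ge0.
  by rewrite mulrCA ler_piMr// ler_pdivrMr// mul1r ler_nat.
by move=> w _; exact: cvg_riemann_sum.
Qed.

(* A right-continuous path is the limit of its values on the grids from above. *)
Lemma right_constant_measurable (f : R -> nat) (c : R) : 0 <= c ->
  (forall s, 0 <= s -> \forall r \near s^'+, f r = f s) ->
  measurable_fun `[0, c] (fun s => (f s)%:R : R).
Proof.
move=> c0 fr.
apply: (measurable_fun_cvg (h := fun m s => (f (grid c m s))%:R)).
  move=> m; pose e (s : R) : nat := ceiln (m.+1%:R * Num.max 0 s).
  apply: (eq_measurable_fun
    (fun s : R => (f (Num.min c ((e s)%:R / m.+1%:R)))%:R : R)).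
    move=> s; rewrite inE/= in_itv/= => /andP[s0 _].
    by rewrite /e max_r.
  apply: measurable_funTS.
  apply: (measurableT_comp (f := fun k : nat => (f (Num.min c (k%:R / m.+1%:R)))%:R : R)) => //.
  apply: measurable_nat_fun => k.
  have me : measurable_fun [set: R] (fun s => (e s)%:R : R).
    apply: nondecreasing_measurable => // r s rs; rewrite ler_nat.
    have p0 x : 0 <= m.+1%:R * Num.max 0 x :> R by rewrite mulr_ge0// le_max lexx.
    rewrite ceiln_le//; have /andP[h _] := ceiln_itv (p0 s).
    apply: le_trans h; rewrite ler_pM2l// ge_max !le_max lexx/=.
    by rewrite rs orbT.
  rewrite (_ : [set _ | _] = [set: R] `&` (fun s => (e s)%:R : R) @^-1` [set k%:R]).
    exact: me.
  apply/seteqP; split => s /=; first by move=> ->.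
  by move=> [_ /eqP]; rewrite eqr_nat => /eqP.
move=> s /=; rewrite in_itv/= => /andP[s0 sc].
have /at_rightE[e e0 fe] := fr s s0.
apply: cvg_near_cst; near=> m.
have : grid c m s < s + e.
  by near: m; apply: (cvgr_lt s); [exact: cvg_grid|rewrite ltrDl].
have := grid_ge m s0 sc; rewrite le_eqVlt => /predU1P[<-//|sg] ge.
by rewrite fe.
Unshelve. all: by end_near. Qed.

End running_integral.

(** * The queueing equation along a path *)

Section queue_path.
Context {R : realType}.
Variables (mu : R) (A S Q : R -> nat).
Implicit Types (r s t u : R) (k : nat).

Definition clock t : R := mu * running_integral (fun s => (Q s)%:R) t.

(** [A] is the arrival path already run at its rate. The equation is rearranged into sums, so that
    it can be stated in [nat] without truncated subtraction. *)
Record queue_path : Prop := QueuePath {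
  qp_rate : 0 < mu ;
  qp_arrivals : forall s t, 0 <= s -> s <= t -> (A s <= A t)%N ;
  qp_services : forall s t, 0 <= s -> s <= t -> (S s <= S t)%N ;
  qp_services_right : forall t, 0 <= t -> \forall s \near t^'+, S s = S t ;
  qp_queue_right : forall t, 0 <= t -> \forall s \near t^'+, Q s = Q t ;
  qp_equation : forall t, 0 <= t -> (Q t + S (clock t) = Q 0 + A t)%N
}.

Hypothesis qp : queue_path.

Let D t : nat := S (clock t).

Lemma qp_queue_le t : 0 <= t -> (Q t <= Q 0 + A t)%N.
Proof. by move=> t0; rewrite -(qp_equation qp t0) leq_addr. Qed.

Lemma nat_nondecreasing_path (f : R -> nat) :
  (forall s t, 0 <= s -> s <= t -> (f s <= f t)%N) ->
  nondecreasing_path (fun s => (f s)%:R : R).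
Proof. by move=> h r s r0 rs; rewrite ler_nat h. Qed.

Lemma qp_queue_integrable : integrable_path (fun s => (Q s)%:R : R).
Proof.
move=> t; have [t0|t0] := leP 0 t; last first.
  by rewrite set_itv_ge ?bnd_simp -?ltNge//; exact: integrable_set0.
apply: (@measurable_bounded_path _ _ _ (Q 0 + A t)%:R).
  by apply: right_constant_measurable => // s s0; exact: (qp_queue_right qp).
move=> s s0 st; rewrite ger0_norm// ler_nat (leq_trans (qp_queue_le s0))//.
by rewrite leq_add2l (qp_arrivals qp).
Qed.

Lemma clock0 : clock 0 = 0.
Proof. by rewrite /clock running_integral0 mulr0. Qed.

Lemma clock_nondecreasing : nondecreasing_path clock.
Proof.
move=> s t s0 st; rewrite ler_pM2l ?(qp_rate qp)// -subr_ge0.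
have := running_integralB_ge (c := 0) qp_queue_integrable s0 st.
by rewrite mul0r; apply.
Qed.

Lemma clock_ge0 t : 0 <= t -> 0 <= clock t.
Proof. by move=> t0; rewrite -clock0 clock_nondecreasing. Qed.

(** Departures only shorten the queue, so on [[0, t]] it never exceeds the initial length plus the
    arrivals. No service enters the resulting bound, which becomes [K] for the service clock. *)
Lemma clock_le t : 0 <= t -> clock t <= mu * t * (Q 0 + A t)%:R.
Proof.
move=> t0; rewrite -mulrA ler_pM2l ?(qp_rate qp)//.
have := running_integralB_le (c := (Q 0 + A t)%:R) qp_queue_integrable (lexx _) t0.
rewrite running_integral0 !subr0 mulrC; apply => s s0 st.
rewrite ler_nat (leq_trans (qp_queue_le (ltW s0)))//.
by rewrite leq_add2l (qp_arrivals qp)// ltW.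
Qed.

Lemma departures_nondecreasing s t : 0 <= s -> s <= t -> (D s <= D t)%N.
Proof.
by move=> s0 st; rewrite (qp_services qp)// ?clock_ge0// clock_nondecreasing.
Qed.

(** The clock recomputed from a candidate departure path [f], with [Q 0 + A - f] in place of [Q]. It
    integrates nondecreasing paths separately, so that Riemann sums apply to each. *)
Definition clock_with (f : R -> nat) t : R :=
  mu * ((Q 0)%:R * t + running_integral (fun s => (A s)%:R) t -
        running_integral (fun s => (f s)%:R) t).

Let arrivals_integrable : integrable_path (fun s => (A s)%:R : R).
Proof.
by apply: nondecreasing_path_integrable; apply: nat_nondecreasing_path;
  exact: (qp_arrivals qp).
Qed.

Lemma clockE t : 0 <= t -> clock t = clock_with D t.
Proof.
move=> t0; rewrite /clock /clock_with; congr (_ * _).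
have iD : integrable_path (fun s => (D s)%:R : R).
  by apply: nondecreasing_path_integrable; apply: nat_nondecreasing_path;
    exact: departures_nondecreasing.
have i0 := integrable_path_cst (R := R) (Q 0)%:R.
rewrite -(running_integral_cst (Q 0)%:R t0) -running_integralD//.
have iQA := integrable_pathD i0 arrivals_integrable.
rewrite -running_integral_sub//.
apply: eq_running_integral => s s0 _; apply/eqP; rewrite eq_sym subr_eq -!natrD.
by rewrite -(qp_equation qp s0).
Qed.

Lemma clock_right t : 0 <= t -> clock s @[s --> t^'+] --> clock t.
Proof.
move=> t0; rewrite clockE//.
have : clock_with D s @[s --> t^'+] --> clock_with D t.
  rewrite /clock_with; apply: cvgM; first exact: cvg_cst.
  apply: cvgB; last first.
    by apply: running_integral_right => //; apply: nat_nondecreasing_path;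
      exact: departures_nondecreasing.
  apply: cvgD; last first.
    by apply: running_integral_right => //; apply: nat_nondecreasing_path;
      exact: (qp_arrivals qp).
  by apply: cvgM; [exact: cvg_cst|exact: cvg_at_right_filter].
apply: cvg_trans; apply: near_eq_cvg; near=> s.
by rewrite -clockE// (le_trans t0)// ltW//; near: s; exact: nbhs_right_gt.
Unshelve. all: by end_near. Qed.

Lemma clock_left t : 0 < t -> clock s @[s --> t^'-] --> clock t.
Proof.
move=> t0; rewrite clockE ?ltW//.
have : clock_with D s @[s --> t^'-] --> clock_with D t.
  rewrite /clock_with; apply: cvgM; first exact: cvg_cst.
  apply: cvgB; last first.
    by apply: running_integral_left => //; apply: nat_nondecreasing_path;
      exact: departures_nondecreasing.
  apply: cvgD; last first.
    by apply: running_integral_left => //; apply: nat_nondecreasing_path;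
      exact: (qp_arrivals qp).
  by apply: cvgM; [exact: cvg_cst|exact: cvg_at_left_filter].
apply: cvg_trans; apply: near_eq_cvg; near=> s.
by rewrite -clockE// ltW//; near: s; exact: nbhs_left_gt.
Unshelve. all: by end_near. Qed.

(* Departures when the service process is frozen at level [u] of the clock. *)
Definition frozen u t : nat := S (Num.min u (clock t)).

Lemma frozen_nondecreasing u : 0 <= u ->
  forall s t, 0 <= s -> s <= t -> (frozen u s <= frozen u t)%N.
Proof.
move=> u0 s t s0 st; rewrite (qp_services qp)//.
  by rewrite le_min u0 clock_ge0.
by rewrite le_min !ge_min lexx/= clock_nondecreasing// orbT.
Qed.

Lemma frozen_le u t : 0 <= u -> 0 <= t -> (frozen u t <= D t)%N.
Proof.
move=> u0 t0; rewrite (qp_services qp)// ?le_min ?u0 ?clock_ge0//.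
by rewrite ge_min lexx orbT.
Qed.

Lemma frozenE u t : clock t <= u -> frozen u t = D t.
Proof. by move=> h; rewrite /frozen min_r. Qed.

(** Fewer departures leave a longer queue, and a longer queue drives the clock faster. *)
Lemma clock_with_ge f t : 0 <= t ->
  (forall s t, 0 <= s -> s <= t -> (f s <= f t)%N) ->
  (forall s, 0 <= s -> (f s <= D s)%N) -> clock t <= clock_with f t.
Proof.
move=> t0 fnd fD; rewrite clockE// ler_pM2l ?(qp_rate qp)// lerD2l lerN2.
apply: le_running_integral.
- by apply: nondecreasing_path_integrable; exact: nat_nondecreasing_path.
- by apply: nondecreasing_path_integrable; apply: nat_nondecreasing_path;
    exact: departures_nondecreasing.
- by move=> s s0 _; rewrite ler_nat fD.
Qed.

Lemma clock_withE f t : 0 <= t -> (forall s, 0 <= s -> s <= t -> f s = D s) ->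
  clock_with f t = clock t.
Proof.
move=> t0 fD; rewrite clockE// /clock_with; congr (_ * (_ - _)).
by apply: eq_running_integral => s s0 st; rewrite fD.
Qed.

(* Up to the [k.+1]-st departure the truncated count is exact, afterwards it only
   makes the clock run faster. *)
Lemma frozen_gt u t k : 0 <= u -> 0 <= t ->
  (k < frozen u t)%N =
  (k < S (Num.min u (clock_with (fun s => minn (frozen u s) k) t)))%N.
Proof.
move=> u0 t0; set f := fun s => minn (frozen u s) k.
have fnd s r : 0 <= s -> s <= r -> (f s <= f r)%N.
  by move=> s0 sr; rewrite leq_min !geq_min leqnn orbT andbT frozen_nondecreasing.
have fD s : 0 <= s -> (f s <= D s)%N.
  by move=> s0; rewrite geq_min frozen_le.
have Cf := clock_with_ge t0 fnd fD; have C0 := clock_ge0 t0.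
apply/idP/idP => [kD|].
  apply: (leq_trans kD); apply: (qp_services qp); first by rewrite le_min u0.
  by rewrite le_min !ge_min lexx/= Cf orbT.
(* There are at most [k] frozen departures by time [t]. If the clock has not passed [u], freezing
   and truncation change nothing up to [t]; if it has, both clocks are cut at [u]. *)
apply: contraLR; rewrite -!leqNgt => Dk; have [Cu|uC] := leP (clock t) u.
  suff -> : clock_with f t = clock t by exact: Dk.
  apply: clock_withE => // s s0 st;
    have Cs : clock s <= u by rewrite (le_trans _ Cu)// clock_nondecreasing.
  rewrite /f frozenE//; apply/minn_idPl.
  by rewrite -(frozenE Cs) (leq_trans _ Dk)// frozen_nondecreasing.
rewrite min_l; last by rewrite ltW// (lt_le_trans uC).
by move: Dk; rewrite /frozen min_l// ltW.
Qed.

Lemma clock_le_frozen u t : 0 <= u -> 0 <= t ->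
  (clock t <= u) = (clock_with (frozen u) t <= u).
Proof.
move=> u0 t0; have Cf := clock_with_ge t0 (frozen_nondecreasing u0)
  (fun s => @frozen_le u s u0).
apply/idP/idP => [Cu|]; last exact: le_trans.
rewrite clock_withE// => s s0 st; rewrite frozenE//.
by rewrite (le_trans _ Cu)// clock_nondecreasing.
Qed.

End queue_path.

(** * Measurability of the departures and of the clock *)

Section queue_measurability.
Context {d : measure_display} {T : measurableType d} {R : realType}.
Variables (mu : R) (A S Q : R -> T -> nat).
Hypothesis qp : forall w, queue_path mu (A ^~ w) (S ^~ w) (Q ^~ w).
Variable G : set (set T).
Hypothesis sG : sigma_algebra [set: T] G.
Implicit Types (s t u : R) (k : nat).

Let C t w := clock mu (Q ^~ w) t.

Let gmeasE := sigma_algebra_measurableE sG.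

Lemma measurable_wrtP (Y : T -> R) :
  measurable_wrt G Y <-> measurable_fun [set: g_sigma_algebraType G] Y.
Proof.
split=> [GY _ U mU|mY U mU]; first by rewrite setTI gmeasE; exact: GY.
by rewrite -gmeasE -[X in measurable X]setTI; exact: mY.
Qed.

Lemma nat_measurable_wrt (Y : T -> nat) : (forall k, G [set w | Y w = k]) ->
  measurable_fun [set: g_sigma_algebraType G] (fun w => (Y w)%:R : R).
Proof.
move=> GY; apply: (measurableT_comp (f := fun k => k%:R : R)) => //.
by apply: (@measurable_nat_fun _ (g_sigma_algebraType G)) => k; rewrite gmeasE.
Qed.

Lemma measurable_nat_gt (Y : T -> nat) : (forall k, G [set w | (k < Y w)%N]) ->
  forall k, G [set w | Y w = k].
Proof.
move=> GY k; have GC j : G [set w | (Y w <= j)%N].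
  rewrite (_ : [set _ | _] = ~` [set w | (j < Y w)%N]).
    exact: sigma_algebra_setC.
  by apply/seteqP; split => w /=; [rewrite leqNgt => /negP|move=> /negP; rewrite -leqNgt].
case: k => [|k].
  rewrite (_ : [set _ | _] = [set w | (Y w <= 0)%N])//.
  by apply/seteqP; split => w /=; [move=> ->|rewrite leqn0 => /eqP].
rewrite (_ : [set _ | _] = [set w | (Y w <= k.+1)%N] `&` [set w | (k < Y w)%N]).
  exact: sigma_algebra_setI.
apply/seteqP; split => w /=; first by move=> ->.
by move=> [h1 h2]; apply/eqP; rewrite eqn_leq h1.
Qed.

Lemma measurable_clock_with (f : R -> T -> nat) t : 0 <= t ->
  (forall k, G [set w | Q 0 w = k]) ->
  (forall s k, 0 <= s -> s <= t -> G [set w | A s w = k]) ->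
  (forall w s r, 0 <= s -> s <= r -> (f s w <= f r w)%N) ->
  (forall s k, 0 <= s -> s <= t -> G [set w | f s w = k]) ->
  measurable_fun [set: g_sigma_algebraType G]
    (fun w => clock_with mu (A ^~ w) (Q ^~ w) (f ^~ w) t).
Proof.
move=> t0 GQ GA fnd Gf; rewrite /clock_with; apply: measurable_funM => //.
apply: measurable_funB.
  apply: measurable_funD.
    by apply: measurable_funM => //; exact: nat_measurable_wrt.
  apply: (@measurable_running_integral _ _ (g_sigma_algebraType G) (fun s w => (A s w)%:R)) => //.
    by move=> w; apply: nat_nondecreasing_path; exact: (qp_arrivals (qp w)).
  by move=> s s0 st; apply: nat_measurable_wrt => k; exact: GA.
apply: (@measurable_running_integral _ _ (g_sigma_algebraType G) (fun s w => (f s w)%:R)) => //.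
  by move=> w; apply: nat_nondecreasing_path; exact: fnd.
by move=> s s0 st; apply: nat_measurable_wrt => k; exact: Gf.
Qed.

Variable h : R.
Hypothesis GQ : forall k, G [set w | Q 0 w = k].
Hypothesis GA : forall s k, 0 <= s -> s <= h -> G [set w | A s w = k].

(** A random level is inserted into [S] by countably many events. By right-continuity and
    monotonicity, when [X < u] one has [S X <= k] exactly if [S q <= k] for some rational [q] with
    [X < q <= u] or [S u <= k]; no service beyond [u] is consulted. *)
Lemma measurable_service_at u k (X : T -> R) : 0 <= u ->
  (forall s k, 0 <= s -> s <= u -> G [set w | S s w = k]) ->
  measurable_fun [set: g_sigma_algebraType G] X -> (forall w, 0 <= X w) ->
  G [set w | (k < S (Num.min u (X w)) w)%N].
Proof.
move=> u0 GS mX X0.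
have GSle s j : 0 <= s -> s <= u -> G [set w | (S s w <= j)%N].
  move=> s0 su;
    rewrite (_ : [set _ | _] = \bigcup_(i in [set i | (i <= j)%N]) [set w | S s w = i]).
    by apply: sigma_algebra_bigcup_nat => // i _; exact: GS.
  by apply/seteqP; split => [w /= ?|w [i /= ? ->]//]; exists (S s w).
rewrite (_ : [set _ | _] = ~` ([set w | (S u w <= k)%N] `|`
    \bigcup_(q : rat) (if (0 <= (ratr q : R) <= u) then
       [set w | X w < ratr q] `&` [set w | (S (ratr q) w <= k)%N] else set0))).
  apply: sigma_algebra_setC => //; apply: sigma_algebra_setU => //; first exact: GSle.
  apply: sigma_algebra_bigcup_rat => // q; case: ifP => [/andP[q0 qu]|_];
    last by case: sG.
  apply: sigma_algebra_setI => //; last exact: GSle.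
  rewrite -gmeasE -[X in measurable X]setTI -preimage_itvNyo; exact: mX.
apply/seteqP; split => w /=.
  move=> kS [Suk|[q _]].
    have := leq_trans kS (qp_services (qp w) _ (_ : Num.min u (X w) <= u)).
    by rewrite ltnNge Suk => /(_ _ _)/= F; have := F;
      rewrite le_min u0 X0 ge_min lexx => /(_ isT isT).
  case: ifP => // /andP[q0 qu] [/= Xq Sqk].
  have : (S (Num.min u (X w)) w <= S (ratr q) w)%N.
    by apply: (qp_services (qp w)); rewrite ?le_min ?u0 ?X0// ge_min (ltW Xq) orbT.
  by move=> /(leq_trans kS); rewrite ltnNge Sqk.
move=> nk; rewrite ltnNge; apply/negP => Sk; apply: nk.
have [Xu|uX] := ltP (X w) u; last by left; move: Sk; rewrite min_l.
right; move: Sk; rewrite min_r ?ltW// => Sk.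
have /at_rightE[e e0 Se] := qp_services_right (qp w) (X0 w).
have : X w < Num.min u (X w + e) by rewrite lt_min Xu ltrDl.
move=> /rat_in_itvoo[q]; rewrite in_itv/= lt_min => /andP[Xq /andP[qu qe]].
exists q => //; rewrite (ltW qu) (le_trans (X0 w) (ltW Xq))/=; split => //=.
by rewrite Se.
Qed.

(** Strong induction on [k] breaks the circle between clock and departures: by [frozen_gt] the event
    depends on a clock driven by the count truncated at [k], and the events [{j < count}] of that
    count are covered by induction for [j < k] and empty otherwise. *)
Lemma measurable_frozen_gt u : 0 <= u ->
  (forall s k, 0 <= s -> s <= u -> G [set w | S s w = k]) ->
  forall k t, 0 <= t -> t <= h ->
    G [set w | (k < frozen mu (S ^~ w) (Q ^~ w) u t)%N].
Proof.
move=> u0 GS; elim/ltn_ind => k IH t t0 th.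
pose f s w := minn (frozen mu (S ^~ w) (Q ^~ w) u s) k.
rewrite (_ : [set _ | _] = [set w | (k < S (Num.min u
    (clock_with mu (A ^~ w) (Q ^~ w) (f ^~ w) t)) w)%N]); last first.
  by apply/seteqP; split => w /=; rewrite (frozen_gt (qp w))//.
have fnd w s r : 0 <= s -> s <= r -> (f s w <= f r w)%N.
  by move=> s0 sr;
    rewrite leq_min !geq_min leqnn orbT andbT (frozen_nondecreasing (qp w)).
apply: measurable_service_at => //; last first.
  move=> w; apply: le_trans (clock_ge0 (qp w) t0) _.
  apply: (clock_with_ge (qp w) t0 (fnd w)) => s s0.
  by rewrite geq_min (frozen_le (qp w)).
apply: measurable_clock_with => //.
  by move=> s j s0 st; apply: GA => //; exact: le_trans th.
move=> s j s0 st; apply: measurable_nat_gt => {}j.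
have [jk|kj] := ltnP j k.
  rewrite (_ : [set _ | _] = [set w | (j < frozen mu (S ^~ w) (Q ^~ w) u s)%N]).
    by apply: IH => //; exact: le_trans th.
  by apply/seteqP; split => w /=; rewrite leq_min jk andbT.
rewrite (_ : [set _ | _] = set0); first by case: sG.
by apply/seteqP; split => w //=; rewrite leq_min [X in _ && X]ltnNge kj andbF.
Qed.

Lemma measurable_clock_le u t : 0 <= u ->
  (forall s k, 0 <= s -> s <= u -> G [set w | S s w = k]) ->
  0 <= t -> t <= h -> G [set w | C t w <= u].
Proof.
move=> u0 GS t0 th.
rewrite (_ : [set _ | _] = [set w | clock_with mu (A ^~ w) (Q ^~ w)
    (frozen mu (S ^~ w) (Q ^~ w) u) t <= u]); last first.
  by apply/seteqP; split => w /=; rewrite -(clock_le_frozen (qp w)).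
have m : measurable_fun [set: g_sigma_algebraType G] (fun w =>
    clock_with mu (A ^~ w) (Q ^~ w) (frozen mu (S ^~ w) (Q ^~ w) u) t).
  apply: (@measurable_clock_with (fun s w => frozen mu (S ^~ w) (Q ^~ w) u s)) => //.
  - by move=> s j s0 st; apply: GA => //; exact: le_trans th.
  - by move=> w; exact: (frozen_nondecreasing (qp w)).
  - move=> s j s0 st; apply: measurable_nat_gt => {}j.
    by apply: measurable_frozen_gt => //; exact: le_trans th.
rewrite -gmeasE -[X in measurable X]setTI -preimage_itvNyc; exact: m.
Qed.

(** This serves the arrival side, where the whole service process is observed: each path is frozen
    at an integer level beyond its clock, where freezing has no effect. *)
Lemma measurable_departures t k :
  (forall s k, 0 <= s -> G [set w | S s w = k]) ->
  0 <= t -> t <= h -> G [set w | S (C t w) w = k].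
Proof.
move=> GS t0 th; apply: measurable_nat_gt => {}k.
rewrite (_ : [set _ | _] = \bigcup_n [set w | (k < frozen mu (S ^~ w) (Q ^~ w) n%:R t)%N]).
  apply: sigma_algebra_bigcup_nat => // n _; apply: measurable_frozen_gt => //.
  by move=> s j s0 _; exact: GS.
apply/seteqP; split => w /=; last first.
  by move=> [n _ /= /leq_trans]; apply; exact: (frozen_le (qp w)).
move=> kS; exists (Num.bound (C t w)) => //=; rewrite frozenE//.
by rewrite ltW// archi_boundP// (clock_ge0 (qp w)).
Qed.

End queue_measurability.

(** * Quadratic variations of a time-changed Poisson process *)

Section unit_jumps.
Context {d : measure_display} {T : measurableType d} {R : realType}.
Variable P : probability T R.
Variable N : R -> {RV P >-> nat}.
Hypothesis NP : poisson_process 1 N.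
Implicit Types (u v x y : R).

Lemma poisson_two_jumps u v : 0 <= u -> u < v ->
  (P [set w | (1 < N v w - N u w)%N] <= ((v - u) ^+ 2)%:E)%E.
Proof.
move=> u0 uv; pose x := v - u; have x0 : 0 < x by rewrite subr_gt0.
have p k : P [set w | (N v w - N u w)%N = k] = (poisson_pmf x k)%:E.
  by rewrite (poisson_process_increment NP)// mul1r.
have mI k : measurable [set w | (N v w - N u w)%N = k].
  exact: (measurable_increment (N u) (N v) [set k]).
rewrite (_ : [set _ | _] = ~` ([set w | (N v w - N u w)%N = 0%N] `|`
    [set w | (N v w - N u w)%N = 1%N])); last first.
  apply/seteqP; split => w /=; first by move=> + [] h; rewrite h.
  by case: (N v w - N u w)%N => [|[|]] //= []; [left|right].
rewrite probability_setC; last exact: measurableU.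
rewrite measureU//; last first.
  by apply/seteqP; split => // w [/= ->].
apply: (@le_trans _ _ (1 - (poisson_pmf x 0 + poisson_pmf x 1))%:E).
  by rewrite EFinB EFinD -!p lexx.
rewrite lee_fin /poisson_pmf x0 expr0 expr1 fact0 !invr1 !mulr1 mul1r.
(* Since [expR (- x) >= 1 - x], the quantity [1 - expR (- x) * (1 + x)] is at most
   [1 - (1 - x) * (1 + x) = x ^+ 2]. *)
have h1 := expR_ge1Dx (- x).
have h2 : (1 - x) * (1 + x) <= expR (- x) * (1 + x).
  by rewrite ler_wpM2r// addr_ge0// ltW.
by rewrite -/x; nra.
Qed.

(** A jump of at least two before [b.+1] shows up, for every [k], as an increment of at least two
    over one of [k.+1] intervals of length [h b k]. Each has probability at most [h b k ^+ 2], in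
    total [b.+1 ^+ 2 / k.+1], which tends to 0. *)
Lemma poisson_unit_jumps : {ae P, forall w, forall x, 0 < x ->
  exists2 y, 0 <= y < x & (N x w <= (N y w).+1)%N}.
Proof.
pose h (b k : nat) : R := b.+1%:R / k.+1%:R.
have h0 b k : 0 < h b k by rewrite divr_gt0.
pose I b k i := [set w | (1 < N (i.+1%:R * h b k) w - N (i%:R * h b k) w)%N].
have mI b k i : measurable (I b k i).
  exact: (measurable_increment (N _) (N _) [set j | (1 < j)%N]).
pose A b := \bigcap_k \big[setU/set0]_(i < k.+1) I b k i.
have mU b k : measurable (\big[setU/set0]_(i < k.+1) I b k i).
  by apply: bigsetU_measurable => i _.
have A0 b : P.-negligible (A b).
  apply/negligibleP; first by apply: bigcapT_measurable.
  apply/eqP; rewrite eq_le measure_ge0 andbT.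
  have le k : (P (A b) <= (b.+1%:R ^+ 2 * k.+1%:R^-1)%:E)%E.
    apply: (@le_trans _ _ (P (\big[setU/set0]_(i < k.+1) I b k i))).
      apply: le_measure; rewrite ?inE//; first exact: bigcapT_measurable.
      exact: bigcap_inf.
    apply: (le_trans (Boole_inequality _ _)) => //.
    apply: (@le_trans _ _ (\sum_(i < k.+1) (h b k ^+ 2)%:E)%E).
      apply: lee_sum => i _.
      apply: (le_trans (poisson_two_jumps _ _)).
      - by rewrite mulr_ge0// ltW.
      - by rewrite ltr_pM2r// ltr_nat.
      - by rewrite -mulrBl -natrB// subSnn mul1r.
    rewrite sumEFin sumr_const card_ord lee_fin -mulr_natl /h expr_div_n.
    rewrite [X in X <= _](_ : _ = b.+1%:R ^+ 2 / k.+1%:R * (k.+1%:R / k.+1%:R)).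
      by rewrite divff ?mulr1// pnatr_eq0.
    by rewrite expr2 invfM; ring.
  have lim : (b.+1%:R ^+ 2 * k.+1%:R^-1)%:E @[k --> \oo] --> (0 : \bar R).
    apply: cvg_EFin; first by near=> k.
    rewrite -[X in _ --> X](mulr0 (b.+1%:R ^+ 2)); apply: cvgM; first exact: cvg_cst.
    exact: cvg_harmonic.
  rewrite -(cvg_lim _ lim)//; apply: lime_ge; first by apply/cvg_ex; eexists; exact: lim.
  exact: nearW.
apply: negligibleS (negligible_bigcup A0) => w /= nQ.
have [x [x0 xw]] : exists x, 0 < x /\ forall y, 0 <= y < x -> (1 < N x w - N y w)%N.
  apply: contrapT => h'; apply: nQ => x x0; apply: contrapT => h''; apply: h'.
  exists x; split => // y yx; rewrite ltn_subRL addn1 ltnNge; apply/negP => h3.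
  by apply: h''; exists y.
exists (Num.bound x) => // k _; set b := Num.bound x.
have xb : x <= b.+1%:R.
  by rewrite ltW// (lt_trans (archi_boundP (ltW x0)))// ltr_nat.
(* [x] lies in the [j]-th interval, from [(j - 1) h] excluded to [j h] included, so the increment
   over it contains the jump at [x]. *)
pose j := ceiln (x / h b k).
have xh0 : 0 <= x / h b k by rewrite divr_ge0// ltW.
have j0 : (0 < j)%N by rewrite ltnNge ceiln_le// -ltNge divr_gt0.
have /andP[xj jx] := ceiln_itv xh0.
have jk : (j <= k.+1)%N.
  by rewrite ceiln_le// ler_pdivrMr// /h mulrCA divff ?mulr1// pnatr_eq0.
rewrite -bigcup_mkord; exists j.-1; first by rewrite /= prednK.
rewrite /I /= prednK//.
have jx' : 0 <= j.-1%:R * h b k < x.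
  apply/andP; split; first by rewrite mulr_ge0// ltW.
  rewrite -ltr_pdivlMr//; move: jx; rewrite -/j -{1}(prednK j0).
  by rewrite -natr1 ltrD2r.
apply: (leq_trans (xw _ jx')); apply: leq_sub2r.
apply: (poisson_process_nondecreasing NP); first exact: ltW.
by rewrite -ler_pdivrMr.
Unshelve. all: by end_near. Qed.

End unit_jumps.

Section predictability.
Context {R : realType}.

Lemma sigma_algebra_preimage_rays (X : Type) (Dom : set X) (H : set (set X))
    (V : X -> R) : sigma_algebra Dom H ->
  (forall a, H (Dom `&` [set z | a < V z])) ->
  forall U : set R, measurable U -> H (Dom `&` V @^-1` U).
Proof.
move=> [H0 HC HU] Hray U mU.
suff : (@RGenOInfty.G R).-sigma.-measurable `<=` [set U | H (Dom `&` V @^-1` U)].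
  by apply; rewrite -RGenOInfty.measurableE.
apply: smallest_sub.
  split => /=; first by rewrite preimage_set0 setI0.
    move=> B HB; rewrite (_ : _ `&` _ = Dom `\` (Dom `&` V @^-1` B)); first exact: HC.
    apply/seteqP; split => z; first by move=> [Dz [_ nB]]; split => // -[].
    by move=> [Dz nB]; split => //; split => // VB; apply: nB.
  by move=> B HB; rewrite preimage_bigcup setI_bigcupr; exact: HU.
move=> _ [a ->] /=; rewrite (_ : _ @^-1` _ = [set z | a < V z])//.
by apply/seteqP; split => z /=; rewrite in_itv/= andbT.
Qed.

Context {d : measure_display} {T : measurableType d}.

(** By left-continuity [a < V t] already holds at some grid point [q < t], and by monotonicity it
    persists from [q] on. So the set is a countable union of rectangles []q, q + l]] times
    [{a < V q}], with the piece at time 0 as index [l = 0]. *)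
Lemma predictable_nondecreasing (F : R -> set (set T)) (V : R -> T -> R) :
  adapted F V -> (forall w, nondecreasing_path (V ^~ w)) ->
  (forall w t, 0 < t -> V s w @[s --> t^'-] --> V t w) -> predictable F V.
Proof.
move=> aV Vnd Vl.
rewrite /predictable; set TS := `[0, +oo[ `*` [set: T]; set H := <<s TS, _ >> => U mU.
have sH : sigma_algebra TS H by exact: smallest_sigma_algebra.
apply: (@sigma_algebra_preimage_rays _ TS H (fun z => V z.1 z.2) sH _ U mU) => a {U mU}.
have [H0 HC HU] := sH.
have FV t : 0 <= t -> F t [set w | a < V t w].
  move=> t0; rewrite (_ : [set _ | _] = V t @^-1` `]a, +oo[); first exact: aV.
  by apply/seteqP; split => w /=; rewrite in_itv/= andbT.
pose q (i j : nat) : R := i%:R / j.+1%:R.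
have q0 i j : 0 <= q i j by rewrite divr_ge0.
have -> : TS `&` [set z | a < V z.1 z.2] =
    \bigcup_l (if l is l'.+1 then \bigcup_i \bigcup_j (`]q i j, q i j + l'.+1%:R] `*`
      [set w | a < V (q i j) w]) else [set 0] `*` [set w | a < V 0 w]).
  apply/seteqP; split => -[t w].
    move=> [[/= + _] aVt]; rewrite in_itv/= andbT le_eqVlt => /predU1P[t0|t0].
      by exists 0%N => //; split => //=; rewrite t0.
    have /at_leftE[e e0 Ve] : \forall s \near t^'-, a < V s w.
      exact: (cvgr_gt _ (Vl w t t0)).
    have [j je] : exists j : nat, j.+1%:R^-1 < e.
      have [j _ /(_ j (leqnn j)) h] : \forall j \near \oo, j.+1%:R^-1 < e.
        by apply: (cvgr_lt (0 : R)) => //; exact: cvg_harmonic.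
      by exists j.
    have jt0 : 0 < j.+1%:R * t by rewrite mulr_gt0.
    (* The last grid point strictly before [t]; the ceiling is positive because [t > 0], so the
       predecessor is not truncated. *)
    pose i := (ceiln (j.+1%:R * t)).-1.
    have ip : (0 < ceiln (j.+1%:R * t))%N by rewrite ltnNge (ceiln_le _ (ltW jt0)) -ltNge.
    have /andP[c1 c2] := ceiln_itv (ltW jt0).
    have iE : (ceiln (j.+1%:R * t))%:R = i%:R + 1 :> R by rewrite natr1 prednK.
    have qt : q i j < t.
      by rewrite ltr_pdivrMr// mulrC; move: c2; rewrite iE ltrD2r.
    have tq : t - e < q i j.
      rewrite ltrBlDr; apply: (@le_lt_trans _ _ (q i j + j.+1%:R^-1));
        last by rewrite ltrD2l.
      rewrite (_ : q i j + _ = (i%:R + 1) / j.+1%:R); last by rewrite mulrDl mul1r.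
      by rewrite -iE ler_pdivlMr// mulrC.
    exists (Num.bound (t - q i j)).+1 => //; exists i => //; exists j => //; split => /=.
      rewrite in_itv/= qt /= -lerBlDl ltW//.
      apply: (lt_trans (archi_boundP _)); first by rewrite subr_ge0 ltW.
      by rewrite ltr_nat.
    exact: Ve.
  move=> [[_ [/= -> aV0]|l _ [i _ [j _ [/=]]]]].
    by split => //; split => //=; rewrite in_itv/= lexx.
  rewrite in_itv/= => /andP[qt _] aVq; split => /=.
    by split => //=; rewrite in_itv/= andbT (le_trans (q0 i j))// ltW.
  by apply: (lt_le_trans aVq); apply: Vnd => //; exact: ltW.
apply: (HU) => -[|l].
  by apply: sub_sigma_algebra; left; exists [set w | a < V 0 w] => //; exact: FV.
apply: (HU) => i; apply: (HU) => j; apply: sub_sigma_algebra; right.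
exists (q i j), (q i j + l.+1%:R), [set w | a < V (q i j) w]; split => //.
  by rewrite ltrDl.
exact: FV.
Qed.

End predictability.

Section quadratic_variations.
Context {d : measure_display} {T : measurableType d} {R : realType}.
Variable P : probability T R.
Variables (G : R -> set (set T)) (N : R -> T -> nat).
Variables (F : R -> set (set T)) (C K : R -> T -> R).
Hypothesis GN : poisson_in_filtration P G N.
Hypothesis CK : clock_for P G N F C K.
Variable c : R.

Let M := time_changed N C c 0.

Let ME t w : M t w = c * ((N (C t w) w)%:R - C t w).
Proof. by rewrite /M /time_changed /charlier mul0r addr0. Qed.

Lemma martingale_local (Z : R -> T -> R) : martingale P F Z -> local_martingale P F Z.
Proof.
move=> mZ; have [aZ _ _ cZ] := mZ; split => //.
exists (fun _ _ => +oo%E); split => //.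
- move=> k; split; first by move=> w; rewrite leey.
  move=> t t0; rewrite (_ : [set _ | _] = set0).
    by have [/(_ t t0)[]] := clk_filtration CK.
  by apply/seteqP; split => w //=; rewrite leye_eq.
- by apply: aeW => w; exact: cvg_cst.
- move=> k; rewrite (_ : stopped Z _ = Z)//.
  by apply/funext => t; apply/funext => w; rewrite /stopped min_l// leey.
Qed.

Lemma time_changed_sqr_martingale : square_integrable_martingale P F M.
Proof.
split; first exact: martingale_time_changed GN CK _ _.
move=> t t0; rewrite unlock.
under eq_integral do rewrite ME exprMn EFinM.
have i2 := time_changed_square_integrable GN CK t0.
by rewrite integralZl// -[X in (_ * X)%E]fineK ?integrable_fin_num// -EFinM ltry.
Qed.

Lemma time_changed_predictable_variation :
  predictable_quadratic_variation P F M (fun t w => c ^+ 2 * C t w).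
Proof.
have C0 t w := clk_ge0 (t := t) CK w.
have Cnd w s t : 0 <= s -> s <= t -> c ^+ 2 * C s w <= c ^+ 2 * C t w.
  by move=> s0 st; rewrite ler_wpM2l ?sqr_ge0// (clk_nondecreasing CK).
split; first exact: time_changed_sqr_martingale.
split; [split|split].
- exact: Cnd.
- by move=> w t t0; rewrite mulr_ge0 ?sqr_ge0// C0.
- apply: predictable_nondecreasing; last 2 first.
  + by move=> w s t; exact: Cnd.
  + by move=> w t t0; apply: cvgM; [exact: cvg_cst|exact: (clk_left CK)].
  move=> t t0; have [/(_ t t0) sF _ _] := clk_filtration CK.
  apply/(measurable_wrtP sF); apply: measurable_funM => //.
  by apply/(measurable_wrtP sF); exact: (clk_adapted CK).
- move=> t t0; have iC := clk_integrable CK t0; rewrite unlock.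
  under eq_integral do rewrite EFinM.
  by rewrite integralZl// -[X in (_ * X)%E]fineK ?integrable_fin_num// -EFinM ltry.
- rewrite (_ : (fun t w => _) = time_changed N C 0 (c ^+ 2)).
    exact: martingale_time_changed GN CK _ _.
  apply/funext => t; apply/funext => w.
  by rewrite ME /time_changed /charlier; ring.
- by move=> _ w; rewrite (clk0 CK) mulr0.
Qed.

Hypothesis Njump : {ae P, forall w, forall x, 0 < x ->
  exists2 y, 0 <= y < x & (N x w <= (N y w).+1)%N}.

(** The clock is continuous, so the jumps of [M] and of the variation are [c] and [c ^+ 2] times the
    jump of the count. The jump relation then says that this integer equals its square, that is, it
    is 0 or 1. *)
Lemma time_changed_optional_variation :
  optional_quadratic_variation P F M (fun t w => c ^+ 2 * (N (C t w) w)%:R).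
Proof.
have Dnd w s t : 0 <= s -> s <= t -> (N (C s w) w <= N (C t w) w)%N.
  exact: (count_nondecreasing GN CK).
have N0 w : N (C 0 w) w = 0%N by rewrite (clk0 CK) (pf0 GN).
split; first by apply: martingale_local; exact: martingale_time_changed GN CK _ _.
split; first by move=> w; rewrite ME N0 (clk0 CK) subrr mulr0.
split.
- by move=> w; rewrite N0 mulr0.
- move=> w t t0; apply: nondecreasing_bounded_variation => r s.
  rewrite !in_itv/= => /andP[r0 _] _ rs.
  by rewrite ler_wpM2l ?sqr_ge0// ler_nat Dnd.
- rewrite (_ : (fun t w => _) = time_changed N C (- c ^+ 2) (c ^+ 2)).
    by apply: martingale_local; exact: martingale_time_changed GN CK _ _.
  apply/funext => t; apply/funext => w.
  by rewrite ME /time_changed /charlier; ring.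
apply: filterS Njump => w Nw t t0.
have [k Dk] := nondecreasing_nat_left_const t0 (@Dnd w).
have -> : jump (M ^~ w) t = c * ((N (C t w) w)%:R - k%:R).
  rewrite /jump (cvg_lim _ (time_changed_left_limit CK t0 Dk))//.
  by rewrite /M /time_changed /charlier; ring.
have -> : jump (fun t => c ^+ 2 * (N (C t w) w)%:R) t =
    c ^+ 2 * ((N (C t w) w)%:R - k%:R).
  rewrite /jump (_ : lim _ = c ^+ 2 * k%:R) ?mulrBr//.
  apply: cvg_lim => //; apply: cvg_near_cst; near=> s; congr (_ * _%:R).
  by near: s.
have kD : (k <= N (C t w) w)%N.
  have [s [s0 st <-]] : exists s, [/\ 0 <= s, s <= t & N (C s w) w = k].
    near t^'- => s; exists s; split; last by near: s.
      by apply: ltW; near: s; exact: nbhs_left_gt.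
    by apply: ltW; near: s; exact: nbhs_left_lt.
  exact: Dnd.
(* By left-continuity the clock passes the level [y] strictly before time [t], so the count [k] just
   before [t] misses at most one of the jumps up to level [C t]. *)
have Dk1 : (N (C t w) w <= k.+1)%N.
  have := clk_ge0 CK w (ltW t0); rewrite le_eqVlt => /predU1P[<-|Ct0].
    by rewrite (pf0 GN).
  have [y /andP[y0 yC] Ny] := Nw _ Ct0.
  near t^'- => s; have s0 : 0 <= s by apply: ltW; near: s; exact: nbhs_left_gt.
  have <- : N (C s w) w = k by near: s.
  rewrite (leq_trans Ny)// ltnS (pf_nondecreasing GN)// ltW//.
  by near: s; apply: (cvgr_gt (C t w)) => //; exact: (clk_left CK).
have : N (C t w) w = k \/ N (C t w) w = k.+1.
  by case: ltngtP kD => // [kD _|->]; [right; apply/eqP; rewrite eqn_leq Dk1|left].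
by case=> ->; rewrite -?natr1; ring.
Unshelve. all: by end_near. Qed.

End quadratic_variations.

(** * The infinite-server queue *)

Section service_system.
Context {d : measure_display} {T : measurableType d} {R : realType}.
Variables (P : probability T R) (mu : R).
Variables (A S : R -> {RV P >-> nat}) (Q : nat -> R -> {RV P >-> nat}) (n : nat).
Hypothesis mu0 : 0 < mu.
Hypothesis AP : poisson_process 1 A.
Hypothesis SP : poisson_process 1 S.
Hypothesis ASi : independent P <<s process_events `[0, +oo[ (fun t => A t) >>
                              <<s process_events `[0, +oo[ (fun t => S t) >>.
Hypothesis Q0i : independent P <<s process_events [set 0] (fun t => Q n t) >>
                  <<s process_events `[0, +oo[ (fun t => A t) `|`
                      process_events `[0, +oo[ (fun t => S t) >>.
Hypothesis Qeq : queue_equation mu A S Q n.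
Hypothesis Qrc : forall w, rc_piecewise_constant (fun t => Q n t w).
Hypothesis EQ0 : ('E_P[(fun w => (Q n 0 w)%:R)%R] < +oo)%E.
Implicit Types (s t u : R) (B : set T) (k : nat).

Let l := arrival_rate mu n.
Let F := queue_filtration mu A S Q n.
Let C t w := service_clock mu Q n t w.

Let eQ := process_events [set 0] (fun t => Q n t).
Let eA := process_events `[0, +oo[ (fun t => A t).
Let eS := process_events `[0, +oo[ (fun t => S t).
Let pastS := past (P := P) S (eQ `|` eA).
Let pastA := past (P := P) A (eQ `|` eS).

Let l0 : 0 <= l. Proof. by rewrite mulr_ge0// ltW. Qed.

Lemma queue_path_of w : queue_path mu (fun s => A (l * s) w) (fun s => S s w)
  (fun s => Q n s w).
Proof.
split => //.
- move=> s t s0 st; apply: (poisson_process_nondecreasing AP).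
    by rewrite mulr_ge0.
  by rewrite ler_wpM2l.
- by move=> s t; exact: (poisson_process_nondecreasing SP).
- by move=> t; exact: (poisson_process_right_continuous SP).
- by move=> t; exact: (Qrc w).1.
- move=> t t0; apply/eqP; rewrite -(eqr_nat R) !natrD; apply/eqP.
  by have := Qeq w t0 => ->; rewrite /departures /arrivals /l subrK.
Qed.

Let meQ : eQ `<=` measurable := @measurable_process_events _ _ _ P _ _ _ (Q n).
Let meA : eA `<=` measurable := @measurable_process_events _ _ _ P _ _ _ A.
Let meS : eS `<=` measurable := @measurable_process_events _ _ _ P _ _ _ S.

Let meQA : eQ `|` eA `<=` measurable.
Proof. by move=> B [/meQ|/meA]. Qed.

Let meQS : eQ `|` eS `<=` measurable.
Proof. by move=> B [/meQ|/meS]. Qed.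

Lemma service_in_past : poisson_in_filtration P pastS (fun t => S t).
Proof. by apply: poisson_in_past => //; exact: independent_setU. Qed.

Lemma arrival_in_past : poisson_in_filtration P pastA (fun t => A t).
Proof.
apply: poisson_in_past => //; apply: independent_setU => //.
  by rewrite setUC.
exact: independentC.
Qed.

Let sF t : sigma_algebra [set: T] (F t).
Proof. exact: smallest_sigma_algebra. Qed.

Let F_queue0 t k : F t [set w | Q n 0 w = k].
Proof. by apply: sub_sigma_algebra; left; left; left; exists 0, [set k]; split. Qed.

Let F_arrivals s t k : 0 <= s -> s <= t -> F t [set w | A (l * s) w = k].
Proof.
move=> s0 st; apply: sub_sigma_algebra; left; left; right; exists s, [set k].
by split => //=; rewrite in_itv/= s0.
Qed.

Let F_departures s t k : 0 <= s -> s <= t -> F t [set w | S (C s w) w = k].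
Proof.
move=> s0 st; apply: sub_sigma_algebra; left; right; exists s, [set k].
by split => //=; rewrite in_itv/= s0.
Qed.

Let pastS_queue0 u B : eQ B -> pastS u B.
Proof. by move=> QB; apply: sub_sigma_algebra; left; left; left. Qed.

Let pastS_arrivals u s U : 0 <= s -> pastS u (A s @^-1` U).
Proof.
move=> s0; apply: sub_sigma_algebra; left; left; right; exists s, U.
by split => //=; rewrite in_itv/= s0.
Qed.

Let pastS_services u s U : 0 <= s -> s <= u -> pastS u (S s @^-1` U).
Proof.
move=> s0 su; apply: sub_sigma_algebra; left; right; exists s, U.
by split => //=; rewrite in_itv/= s0.
Qed.

Let pastA_queue0 u B : eQ B -> pastA u B.
Proof. by move=> QB; apply: sub_sigma_algebra; left; left; left. Qed.

Let pastA_services u s U : 0 <= s -> pastA u (S s @^-1` U).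
Proof.
move=> s0; apply: sub_sigma_algebra; left; left; right; exists s, U.
by split => //=; rewrite in_itv/= s0.
Qed.

Let pastA_arrivals u s U : 0 <= s -> s <= u -> pastA u (A s @^-1` U).
Proof.
move=> s0 su; apply: sub_sigma_algebra; left; right; exists s, U.
by split => //=; rewrite in_itv/= s0.
Qed.

Let queue0_event k : eQ [set w | Q n 0 w = k].
Proof. by exists 0, [set k]; split. Qed.

(** The departures are rebuilt from the initial length, the arrivals up to level [l * t] and the
    service process, which is entirely in the past of level 0. *)
Let sub_pastA t B : 0 <= t -> F t B -> pastA (l * t) B.
Proof.
move=> t0; have lt0 : 0 <= l * t by rewrite mulr_ge0.
suff : F t `<=` pastA (l * t) by apply.
apply: smallest_sub; first exact: smallest_sigma_algebra.
move=> {}B.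
move=> [[[QB|[s [U [/= + _ ->]]]]|[s [U [/= + _ ->]]]]|nB].
- exact: pastA_queue0.
- rewrite in_itv/= => /andP[s0 st]; apply: pastA_arrivals.
    by rewrite mulr_ge0.
  by rewrite ler_wpM2l.
- rewrite in_itv/= => /andP[s0 st].
  rewrite (_ : _ @^-1` _ = \bigcup_(k in U) [set w | S (C s w) w = k]); last first.
    by apply/seteqP; split => [w Uw|w [k + Sk]]; [exists (S (C s w) w)|rewrite -Sk].
  have sP : sigma_algebra [set: T] (pastA (l * t)) by exact: smallest_sigma_algebra.
  apply: (sigma_algebra_bigcup_nat sP) => k _.
  apply: (measurable_departures (h := t) queue_path_of sP) => //.
  + by move=> j; apply: pastA_queue0.
  + move=> r j r0 rt; apply: (@pastA_arrivals (l * t) (l * r) [set j]).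
      by rewrite mulr_ge0.
    by rewrite ler_wpM2l.
  + by move=> r j r0; exact: (@pastA_services (l * t) r [set j]).
- by apply: sub_sigma_algebra; right.
Qed.

Let measurable_F t B : 0 <= t -> F t B -> measurable B.
Proof.
move=> t0 /(sub_pastA t0); apply: (pf_measurable arrival_in_past).
by rewrite mulr_ge0.
Qed.

Lemma filtration_queue : filtration F.
Proof.
split=> [t _||s t s0 st]; [exact: sF|by move=> t t0 B; exact: measurable_F|].
apply: sub_g_sigma_algebraS => B.
move=> [[[QB|[r [U [/= + mU ->]]]]|[r [U [/= + mU ->]]]]|nB]; rewrite ?in_itv/=.
- by apply: sub_sigma_algebra; left; left; left.
- move=> /andP[r0 rs]; apply: sub_sigma_algebra; left; left; right.
  by exists r, U; split => //=; rewrite in_itv/= r0 (le_trans rs).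
- move=> /andP[r0 rs]; apply: sub_sigma_algebra; left; right.
  by exists r, U; split => //=; rewrite in_itv/= r0 (le_trans rs).
- by apply: sub_sigma_algebra; right.
Qed.

(* An event of [F t] restricted to [{C t <= u}] sees the service process only
   up to level [u], where the departures coincide with the frozen ones. *)
Let sub_pastS t u B : 0 <= t -> 0 <= u -> F t B ->
  pastS u (B `&` [set w | C t w <= u]).
Proof.
move=> t0 u0 FB; have sP : sigma_algebra [set: T] (pastS u).
  exact: smallest_sigma_algebra.
have GQ k : pastS u [set w | Q n 0 w = k] by exact: pastS_queue0.
have GA s k : 0 <= s -> s <= t -> pastS u [set w | A (l * s) w = k].
  by move=> s0 _; have := @pastS_arrivals u (l * s) [set k]; apply; rewrite mulr_ge0.
have GS s k : 0 <= s -> s <= u -> pastS u [set w | S s w = k].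
  by move=> s0 su; exact: (pastS_services [set k]).
have CuP : pastS u [set w | C t w <= u].
  exact: (measurable_clock_le queue_path_of sP GQ GA).
suff : F t `<=` [set B | pastS u (B `&` [set w | C t w <= u])] by apply.
apply: smallest_sub.
  split => /=.
  - by rewrite set0I; case: sP.
  - move=> D PD; rewrite (_ : _ `&` _ = [set w | C t w <= u] `&`
      ~` (D `&` [set w | C t w <= u])).
      by apply: (sigma_algebra_setI sP) => //; exact: (sigma_algebra_setC sP).
    apply/seteqP; split => w /=; first by move=> [[_ nD] Cu]; split => // -[].
    by move=> [Cu nD]; split => //; split => // Dw; apply: nD.
  - move=> D PD; rewrite setI_bigcupl.
    by apply: (sigma_algebra_bigcup_nat sP) => k _; exact: PD.
move=> D [[[QD|[s [U [/= + _ ->]]]]|[s [U [/= + _ ->]]]]|nD] /=.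
- by apply: (sigma_algebra_setI sP) => //; exact: pastS_queue0.
- rewrite in_itv/= => /andP[s0 st]; apply: (sigma_algebra_setI sP) => //.
  by apply: pastS_arrivals; rewrite mulr_ge0.
- rewrite in_itv/= => /andP[s0 st].
  rewrite (_ : _ `&` _ = (\bigcup_(k in U) [set w |
      frozen mu (fun s => S s w) (fun s => Q n s w) u s = k]) `&` [set w | C t w <= u]).
    apply: (sigma_algebra_setI sP) => //; apply: (sigma_algebra_bigcup_nat sP) => k _.
    apply: (measurable_nat_gt sP) => {}k.
    by apply: (measurable_frozen_gt queue_path_of sP GQ GA) => //.
  have fE w : C t w <= u ->
      frozen mu (fun s => S s w) (fun s => Q n s w) u s = S (C s w) w.
    move=> Cu; rewrite frozenE//; apply: le_trans Cu.
    exact: (clock_nondecreasing (queue_path_of w)).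
  apply/seteqP; split => w /= [].
    by move=> Uw Cu; split => //; exists (S (C s w) w) => //=; exact: fE.
  by move=> [k + fk] Cu; rewrite -fk /= fE.
- apply: (sigma_algebra_setI sP) => //.
  by apply: sub_sigma_algebra; right.
Qed.

Lemma arrival_clock : clock_for P pastA (fun t => A t) F (fun t _ => l * t) (fun t _ => l * t).
Proof.
split.
- exact: filtration_queue.
- by move=> w; rewrite mulr0.
- by move=> w s t s0 st; rewrite ler_wpM2l.
- by move=> w t t0; apply: cvgM; [exact: cvg_cst|exact: cvg_at_right_filter].
- by move=> w t t0; apply: cvgM; [exact: cvg_cst|exact: cvg_at_left_filter].
- by [].
- by move=> t t0; exact: finite_measure_integrable_cst.
- move=> t c t0;
    have sP : sigma_algebra [set: T] (pastA 0) by exact: smallest_sigma_algebra.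
  have [h|h] := ltP c (l * t).
    rewrite (_ : [set _ | _] = setT); first exact: sigma_algebra_setT.
    by apply/seteqP.
  by have [P0 _ _] := sP; rewrite (_ : [set _ | _] = set0)//; apply/seteqP; split.
- move=> t u B t0 u0 FB; have [h|h] := leP (l * t) u.
    rewrite (_ : _ `&` _ = B); last by apply/seteqP; split => [w []|w].
    apply: (pf_mono arrival_in_past _ h); first by rewrite mulr_ge0.
    exact: sub_pastA.
  rewrite (_ : _ `&` _ = set0); last by apply/seteqP; split => // w [].
  by have [] : sigma_algebra [set: T] (pastA u) by exact: smallest_sigma_algebra.
- by move=> t t0; apply/(measurable_wrtP (sF t)).
- by move=> t k t0; exact: F_arrivals.
Qed.

(** The assumption on the mean of [Q n 0] enters through the integrability of the bound, the mean of
    the arrivals being finite. The bound contains no service, which puts it in [pastS 0]. *)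
Lemma service_clock_for : clock_for P pastS (fun t => S t) F C
  (fun t w => mu * t * (Q n 0 w + A (l * t) w)%:R).
Proof.
split.
- exact: filtration_queue.
- by move=> w; exact: clock0.
- by move=> w; exact: (clock_nondecreasing (queue_path_of w)).
- by move=> w t t0; exact: (clock_right (queue_path_of w)).
- by move=> w t t0; exact: (clock_left (queue_path_of w)).
- by move=> w t t0; exact: (clock_le (queue_path_of w)).
- move=> t t0; have lt0 : 0 <= l * t by rewrite mulr_ge0.
  have iQ : P.-integrable [set: T] (EFin \o (fun w => (Q n 0 w)%:R : R)).
    apply/integrableP; split.
      apply/measurable_EFinP; apply: (measurableT_comp (f := fun k => k%:R : R)) => //.
    under eq_integral do rewrite gee0_abs ?lee_fin//.
    by move: EQ0; rewrite unlock.
  have iA := integrable_pf_quadratic arrival_in_past 0 1 0 lt0.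
  apply: eq_integrable (integrableZl measurableT (mu * t) (integrableD measurableT iQ iA)) => //.
  by move=> w _ /=; rewrite -EFinD -EFinM natrD; congr EFin; ring.
- move=> t c t0;
    have sP : sigma_algebra [set: T] (pastS 0) by exact: smallest_sigma_algebra.
  have m : measurable_fun [set: g_sigma_algebraType (pastS 0)]
      (fun w => mu * t * (Q n 0 w + A (l * t) w)%:R : R).
    apply: measurable_funM => //.
    under eq_fun do rewrite natrD.
    apply: measurable_funD; apply: (nat_measurable_wrt sP) => k.
      exact: pastS_queue0.
    by have := @pastS_arrivals 0 (l * t) [set k]; apply; rewrite mulr_ge0.
  rewrite -(sigma_algebra_measurableE sP) -[X in measurable X]setTI -preimage_itvoy.
  exact: m.
- by move=> t u B; exact: sub_pastS.
- move=> t t0; apply/(measurable_wrtP (sF t)).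
  have m : measurable_fun [set: g_sigma_algebraType (F t)] (fun w =>
      clock_with mu (fun s => A (l * s) w) (fun s => Q n s w) (fun s => S (C s w) w) t).
    apply: (@measurable_clock_with _ _ _ mu (fun s w => A (l * s) w) (fun s w => S s w)
      (fun s w => Q n s w) queue_path_of _ (sF t) (fun s w => S (C s w) w)) => //.
    - by move=> s k; exact: F_arrivals.
    - by move=> w; exact: (departures_nondecreasing (queue_path_of w)).
    - by move=> s k; exact: F_departures.
  apply: eq_measurable_fun m => w _.
  by rewrite -(clockE (queue_path_of w)).
- by move=> t k t0; exact: F_departures.
Qed.

(** Centering the queue at [n] contributes [mu * n * t] to the integral term, and this is exactly
    the compensator of arrivals at rate [n * mu]; the service compensators cancel by definition of
    the clock. *)
Lemma queue_integral_identity w t : (0 < n)%N -> 0 <= t ->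
  scaled_queue Q n t w = scaled_queue Q n 0 w + centered_arrivals mu A n t w -
    centered_departures mu S Q n t w -
    mu * \int[lebesgue_measure]_(s in `[0, t]) scaled_queue Q n s w.
Proof.
move=> n0 t0; have sq0 : Num.sqrt n%:R != 0 :> R by rewrite gt_eqF// sqrtr_gt0 ltr0n.
have iQ := qp_queue_integrable (queue_path_of w).
have in_ := integrable_path_cst (R := R) n%:R.
have -> : \int[lebesgue_measure]_(s in `[0, t]) scaled_queue Q n s w =
    (\int[lebesgue_measure]_(s in `[0, t]) (Q n s w)%:R - n%:R * t) / Num.sqrt n%:R.
  rewrite /scaled_queue RintegralZr//; last exact: (integrable_pathB iQ in_).
  congr (_ / _); rewrite RintegralB//.
  by congr (_ - _); exact: running_integral_cst.
rewrite /centered_departures /centered_arrivals /scaled_queue (Qeq w t0).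
rewrite /service_clock /arrival_rate; field.
exact: sq0.
Qed.

Let sqr_inv_sqrt : (Num.sqrt n%:R)^-1 ^+ 2 = n%:R^-1 :> R.
Proof. by rewrite exprVn sqr_sqrtr. Qed.

Lemma centered_arrivalsE :
  centered_arrivals mu A n = time_changed (fun t w => A t w) (fun t _ => l * t) (Num.sqrt n%:R)^-1 0.
Proof.
apply/funext => t; apply/funext => w.
by rewrite /centered_arrivals /time_changed /charlier mul0r addr0 mulrC.
Qed.

Lemma centered_departuresE :
  centered_departures mu S Q n = time_changed (fun t w => S t w) C (Num.sqrt n%:R)^-1 0.
Proof.
apply/funext => t; apply/funext => w.
by rewrite /centered_departures /time_changed /charlier mul0r addr0.
Qed.

Lemma arrivals_predictable_variation :
  predictable_quadratic_variation P F (centered_arrivals mu A n)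
    (fun t _ => arrival_rate mu n * t / n%:R).
Proof.
rewrite centered_arrivalsE.
have := time_changed_predictable_variation arrival_in_past arrival_clock (Num.sqrt n%:R)^-1.
rewrite (_ : (fun t w => _ ^+ 2 * _) = fun t _ => arrival_rate mu n * t / n%:R)//.
by apply/funext => t; apply/funext => w; rewrite sqr_inv_sqrt mulrC.
Qed.

Lemma departures_predictable_variation :
  predictable_quadratic_variation P F (centered_departures mu S Q n)
    (fun t w => mu / n%:R * \int[lebesgue_measure]_(s in `[0, t]) (Q n s w)%:R).
Proof.
rewrite centered_departuresE.
have := time_changed_predictable_variation service_in_past service_clock_for (Num.sqrt n%:R)^-1.
rewrite (_ : (fun t w => _ ^+ 2 * _) = fun t w =>
  mu / n%:R * \int[lebesgue_measure]_(s in `[0, t]) (Q n s w)%:R)//.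
apply/funext => t; apply/funext => w.
by rewrite sqr_inv_sqrt /C /service_clock mulrA [_^-1 * _]mulrC.
Qed.

Lemma arrivals_optional_variation :
  optional_quadratic_variation P F (centered_arrivals mu A n)
    (fun t w => (A (arrival_rate mu n * t) w)%:R / n%:R).
Proof.
rewrite centered_arrivalsE.
have := time_changed_optional_variation arrival_in_past arrival_clock (Num.sqrt n%:R)^-1
  (poisson_unit_jumps AP).
rewrite (_ : (fun t w => _ ^+ 2 * _) = fun t w => (A (arrival_rate mu n * t) w)%:R / n%:R)//.
by apply/funext => t; apply/funext => w; rewrite sqr_inv_sqrt mulrC.
Qed.

Lemma departures_optional_variation :
  optional_quadratic_variation P F (centered_departures mu S Q n) (fun t w =>
    n%:R^-1 * (S (mu * \int[lebesgue_measure]_(s in `[0, t]) (Q n s w)%:R) w)%:R).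
Proof.
rewrite centered_departuresE.
have := time_changed_optional_variation service_in_past service_clock_for (Num.sqrt n%:R)^-1
  (poisson_unit_jumps SP).
rewrite (_ : (fun t w => _ ^+ 2 * _) = fun t w =>
  n%:R^-1 * (S (mu * \int[lebesgue_measure]_(s in `[0, t]) (Q n s w)%:R) w)%:R)//.
by apply/funext => t; apply/funext => w; rewrite sqr_inv_sqrt.
Qed.

End service_system.

Theorem theorem3p4 (d : measure_display) (T : measurableType d) (R : realType)
    (P : probability T R) (mu : R)
    (A S : R -> {RV P >-> nat}) (Q : nat -> R -> {RV P >-> nat}) :
  0 < mu ->
  poisson_process 1 A ->
  poisson_process 1 S ->
  independent P <<s process_events `[0, +oo[ (fun t => A t) >>
                <<s process_events `[0, +oo[ (fun t => S t) >> ->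
  (forall n, (1 <= n)%N ->
    independent P <<s process_events [set 0] (fun t => Q n t) >>
                  <<s process_events `[0, +oo[ (fun t => A t) `|`
                      process_events `[0, +oo[ (fun t => S t) >>) ->
  (forall n, (1 <= n)%N -> queue_equation mu A S Q n) ->
  (forall n, (1 <= n)%N ->
    forall w, rc_piecewise_constant (fun t => Q n t w)) ->
  (forall n, (1 <= n)%N -> ('E_P[(fun w => (Q n 0 w)%:R)%R] < +oo)%E) ->
  forall n, (1 <= n)%N ->
  let X := scaled_queue Q n in
  let M1 := centered_arrivals mu A n in
  let M2 := centered_departures mu S Q n in
  let F := queue_filtration mu A S Q n in
  let QV1 := fun t (w : T) => arrival_rate mu n * t / n%:R in
  let QV2 := fun t w =>
    mu / n%:R * \int[lebesgue_measure]_(s in `[0, t]) (Q n s w)%:R in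
  (forall w t, 0 <= t ->
    X t w = X 0 w + M1 t w - M2 t w
            - mu * \int[lebesgue_measure]_(s in `[0, t]) X s w) /\
  filtration F /\
  square_integrable_martingale P F M1 /\
  square_integrable_martingale P F M2 /\
  predictable_quadratic_variation P F M1 QV1 /\
  predictable_quadratic_variation P F M2 QV2 /\
  (forall t, 0 <= t -> ('E_P[QV2 t] < +oo)%E) /\
  optional_quadratic_variation P F M1
    (fun t w => (A (arrival_rate mu n * t) w)%:R / n%:R) /\
  optional_quadratic_variation P F M2
    (fun t w =>
      n%:R^-1 * (S (mu * \int[lebesgue_measure]_(s in `[0, t]) (Q n s w)%:R) w)%:R).
Proof.
move=> mu0 AP SP ASi Q0i Qeq Qrc EQ0 n n1 X M1 M2 F QV1 QV2.
have qA : predictable_quadratic_variation P F M1 QV1.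
  exact: (arrivals_predictable_variation mu0 AP SP ASi (Q0i n n1) (Qeq n n1) (Qrc n n1)).
have qS : predictable_quadratic_variation P F M2 QV2.
  exact: (departures_predictable_variation mu0 AP SP ASi (Q0i n n1) (Qeq n n1)
    (Qrc n n1) (EQ0 n n1)).
split.
  by move=> w t; exact: (queue_integral_identity mu0 AP SP (Qeq n n1) (Qrc n n1)).
split; first exact: (filtration_queue mu0 AP SP ASi (Q0i n n1) (Qeq n n1) (Qrc n n1)).
have [sA _] := qA; have [sS [[_ _ _ eS] _]] := qS.
do 5 split => //.
split.
  exact: (arrivals_optional_variation mu0 AP SP ASi (Q0i n n1) (Qeq n n1) (Qrc n n1)).
exact: (departures_optional_variation mu0 AP SP ASi (Q0i n n1) (Qeq n n1)
  (Qrc n n1) (EQ0 n n1)).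
Qed.
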